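(* Let $C_\ast$ be the infimum of all $C>0$ such that $\|f\|_2\le C^d\|f\|_1$ for every $d\ge 1$, every $n\ge 1$ and every $f:\{-1,1\}^n\to\mathbb{R}$ with $\deg f\le d$. Then $$\sqrt3\ \le\ C_\ast\ <\ 2.409 .$$
   Context: For $f:\{-1,1\}^n\to\mathbb{R}$ and $p\ge1$, $\|f\|_p:=\left(2^{-n}\sum_{x\in\{-1,1\}^n}|f(x)|^p\right)^{1/p}$. The degree $\deg f$ is the Fourier--Walsh degree of $f$, i.e. the degree of the unique multilinear polynomial in $x_1,\dots,x_n$ that agrees with $f$ on $\{-1,1\}^n$. Here $d$ and $n$ range over positive integers. *)

(* Defs.v *)
From mathcomp Require Import all_boot all_order all_algebra.
From mathcomp Require Import all_classical all_reals all_analysis.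

Set Implicit Arguments.
Unset Strict Implicit.
Unset Printing Implicit Defensive.

Import Order.TTheory GRing.Theory Num.Theory.

Local Open Scope classical_set_scope.
Local Open Scope ring_scope.

(* {-1,1}^n, encoded by bits: the i-th coordinate of x is (-1) ^+ x i. *)
Definition cube (n : nat) := {ffun 'I_n -> bool}.

Definition coord (R : realType) (n : nat) (x : cube n) (i : 'I_n) : R :=
  (-1) ^+ x i.

Definition pnorm (R : realType) (n : nat) (p : R) (f : cube n -> R) : R :=
  (2 ^- n * \sum_x `|f x| `^ p) `^ p^-1.

Definition walsh (R : realType) (n : nat) (S : {set 'I_n}) (x : cube n) : R :=
  \prod_(i in S) coord R x i.

Definition fourier (R : realType) (n : nat) (f : cube n -> R)
    (S : {set 'I_n}) : R :=
  2 ^- n * \sum_x f x * walsh R S x.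

(* The monomials of a multilinear polynomial are the \prod_(i in S) x_i, and
   [walsh_expansion], [walsh_unique] below show that [fourier f] is the only
   family of coefficients for which the polynomial agrees with f on the cube.
   The zero function gets degree 0. *)
Definition degree (R : realType) (n : nat) (f : cube n -> R) : nat :=
  \max_(S : {set 'I_n} | fourier f S != 0) #|S|.

Definition Cstar (R : realType) : R :=
  inf [set C : R | 0 < C /\
    forall (d n : nat) (f : cube n -> R),
      (1 <= d)%N -> (1 <= n)%N -> (degree f <= d)%N ->
      pnorm 2 f <= C ^+ d * pnorm 1 f].

Lemma walshM_big (R : realType) n (S T : {set 'I_n}) (x y : cube n) :
  walsh R S x * walsh R T y =
  \prod_i ((if i \in S then coord R x i else 1) *
           (if i \in T then coord R y i else 1)).
Proof. by rewrite big_split /walsh /= !(big_mkcond (fun i => i \in _)). Qed.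

Lemma sum_walsh_set (R : realType) n (x y : cube n) :
  \sum_(S : {set 'I_n}) walsh R S x * walsh R S y =
  if x == y then 2 ^+ n else 0.
Proof.
have -> : \sum_(S : {set 'I_n}) walsh R S x * walsh R S y =
          \prod_i (coord R x i * coord R y i + 1).
  rewrite bigA_distr; apply: eq_bigr => S _.
  by rewrite walshM_big; apply: eq_bigr => i _; case: ifP; rewrite ?mulr1.
have [<-|/eqP neq_xy] := eqVneq x y.
  rewrite (eq_bigr (fun=> 2)) ?prodr_const ?card_ord // => i _.
  by rewrite /coord -expr2 sqrr_sign.
have [i neq_i] : exists i, x i != y i.
  apply/existsP; apply: contra_notT neq_xy; rewrite negb_exists => /forallP e.
  by apply/ffunP => i; apply/eqP; rewrite -[_ == _]negbK e.
rewrite (bigD1 i) //= /coord; case: (x i) (y i) neq_i => [] [] // _;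
  by rewrite expr1 expr0 ?mulr1 ?mul1r addNr mul0r.
Qed.

Lemma sum_walsh_cube (R : realType) n (S T : {set 'I_n}) :
  \sum_(x : cube n) walsh R S x * walsh R T x =
  if S == T then 2 ^+ n else 0.
Proof.
pose h (i : 'I_n) (b : bool) : R :=
  (if i \in S then (-1) ^+ b else 1) * (if i \in T then (-1) ^+ b else 1).
have -> : \sum_(x : cube n) walsh R S x * walsh R T x =
          \prod_i (\sum_(b : bool) h i b).
  rewrite bigA_distr_bigA; apply: eq_bigr => x _.
  by rewrite walshM_big.
have [eq_ST|/eqP neq_ST] := eqVneq S T.
  rewrite (eq_bigr (fun=> 2)) ?prodr_const ?card_ord // => i _.
  by rewrite big_bool /h -eq_ST; case: ifP => _ /=;
    rewrite !(expr1, expr0, mulrNN, mulr1).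
have [i neq_i] : exists i, (i \in S) != (i \in T).
  apply/existsP; apply: contra_notT neq_ST; rewrite negb_exists => /forallP e.
  by apply/setP => i; apply/eqP; rewrite -[_ == _]negbK e.
rewrite (bigD1 i) //= big_bool /h.
case: (i \in S) (i \in T) neq_i => [] [] // _;
  by rewrite !expr1 !expr0 ?mulr1 ?mul1r /= addNr mul0r.
Qed.

Lemma walsh_expansion (R : realType) n (f : cube n -> R) (x : cube n) :
  f x = \sum_(S : {set 'I_n}) fourier f S * \prod_(i in S) coord R x i.
Proof.
rewrite /fourier.
under eq_bigr => S _ do rewrite -mulrA mulr_suml.
rewrite -mulr_sumr exchange_big /=.
under eq_bigr => y _.
  under eq_bigr => S _ do rewrite -mulrA.
  rewrite -mulr_sumr sum_walsh_set.
  over.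
rewrite (bigD1 x) //= eqxx big1 ?addr0.
  by rewrite mulrCA mulVf ?mulr1 // expf_neq0 // pnatr_eq0.
by move=> y /negPf ->; rewrite mulr0.
Qed.

Lemma walsh_unique (R : realType) n (f : cube n -> R) (c : {set 'I_n} -> R) :
  (forall x, f x = \sum_(S : {set 'I_n}) c S * \prod_(i in S) coord R x i) ->
  forall S, c S = fourier f S.
Proof.
move=> fE S; rewrite /fourier.
under eq_bigr => x _ do rewrite fE mulr_suml.
rewrite exchange_big /=.
under eq_bigr => T _.
  under eq_bigr => x _ do rewrite -mulrA.
  rewrite -mulr_sumr sum_walsh_cube.
  over.
rewrite (bigD1 S) //= eqxx big1 ?addr0.
  by rewrite mulrCA mulVf ?mulr1 // expf_neq0 // pnatr_eq0.
by move=> T /negPf ->; rewrite mulr0.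
Qed.

(* Main.v *)
(** Upper bound.  Normalise ||f||_2 = 1, write W_k for the Walsh weight of f at
    level k and P(u) = E[f T_u f] = sum_k W_k u^k, where T_u multiplies the
    level-k part of f by u^k; P has degree at most d and P(1) = 1.  By Beckner's
    inequality, T_{iy} maps L^p to L^{p'} with norm 1 when p = 1 + y^2, so
    |P(iy)| <= ||f||_p^2, and log-convexity of the norms bounds this by
    ||f||_1^(2 (1 - y^2) / (1 + y^2)).  If ||f||_1 <= C^(-d), then P is small
    on the segment i[-3/4, 3/4].  The map u = (3/8) (z - 1/z) sends the unit
    circle to this segment and -1/3 to 1, and z^d P(u(z)) is a polynomial.
    With C = e^(7/8) the bound on |P(iy)| is dominated by
    (e^(-7/4) (|19 - 4 z^2| / 15)^3)^d; multiplying by a polynomial that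
    approximates (19 - 4 z^2)^(-3d) and applying the maximum principle at
    z = -1/3 contradicts P(1) = 1.

    Lower bound.  If C is admissible, the squares of the homogeneous parts of
    prod_i (1 + e x_i) give ||G_k||_4 <= C^k ||G_k||_2 for each part G_k.  Hence
    the fourth moment of prod_i (1 + (e/C) x_i) is at most (n + 1)^4 times the
    squared second moment of prod_i (1 + e x_i).  Letting n grow and then e tend
    to 0 gives C^2 >= 3. *)

From mathcomp Require Import all_boot all_order all_algebra.
From mathcomp Require Import all_classical all_reals all_analysis.
From mathcomp Require Import cyclic separable cyclotomic complex.
From mathcomp Require Import ring lra zify.
Require Import Defs.

Set Implicit Arguments.
Unset Strict Implicit.
Unset Printing Implicit Defensive.

Import Order.TTheory GRing.Theory Num.Theory.
Import numFieldNormedType.Exports.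

Local Open Scope classical_set_scope.
Local Open Scope ring_scope.

(** * Minkowski and Hoelder inequalities for finite sums *)

Section Powers.
Variable R : realType.
Implicit Types (a b r p : R).

Lemma exprn_le (a b : R) k : 0 <= a -> a <= b -> a ^+ k <= b ^+ k.
Proof. by move=> a0 ab; apply: lerXn2r; rewrite ?nnegrE// (le_trans a0). Qed.

Lemma sqr_le_le (a b : R) : 0 <= b -> a ^+ 2 <= b ^+ 2 -> a <= b.
Proof.
move=> b0 ab; rewrite leNgt; apply/negP => ba; move: ab; apply/negP.
by rewrite -ltNge ltrXn2r// ltW// (le_lt_trans b0).
Qed.

Lemma powR_convex r (l m a b : R) : 1 <= r -> 0 <= l -> 0 <= m -> l + m = 1 ->
  0 <= a -> 0 <= b -> (l * a + m * b) `^ r <= l * a `^ r + m * b `^ r.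
Proof.
move=> r1 l0 m0 lm a0 b0.
have l1 : l <= 1 by lra.
have := @convex_powR R r r1 (Itv01 l0 l1) a b.
rewrite !inE /= !in_itv /= !andbT a0 b0 => /(_ isT isT).
rewrite [X in X `^ _](_ : _ = l * a + (1 - l) * b); last exact: convRE.
rewrite [X in _ <= X](_ : _ = l * a `^ r + (1 - l) * b `^ r); last exact: convRE.
by have -> : 1 - l = m by lra.
Qed.

(** Convexity of t^(1/r) at the points a^r and b^r, followed by raising to the power r. *)
Lemma powR_concave r (l m a b : R) : 0 < r -> r <= 1 ->
  0 <= l -> 0 <= m -> l + m = 1 ->
  0 <= a -> 0 <= b -> l * a `^ r + m * b `^ r <= (l * a + m * b) `^ r.
Proof.
move=> r0 r1 l0 m0 lm a0 b0.
have ri : 1 <= r^-1 by rewrite invf_ge1.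
have := powR_convex ri l0 m0 lm (powR_ge0 a r) (powR_ge0 b r).
rewrite -!powRrM mulfV ?gt_eqF// !powRr1// => H.
have := ge0_ler_powR (ltW r0) _ _ H.
rewrite !nnegrE powR_ge0 addr_ge0 ?mulr_ge0// => /(_ isT isT).
by rewrite -powRrM mulVf ?gt_eqF// powRr1// addr_ge0 // mulr_ge0 ?powR_ge0.
Qed.

Lemma powR_le r a b : 0 <= r -> 0 <= a -> a <= b -> a `^ r <= b `^ r.
Proof. by move=> r0 a0 ab; apply: ge0_ler_powR; rewrite ?nnegrE // (le_trans a0). Qed.

Lemma powR_le_inv r a b : 0 < r -> 0 <= a -> 0 <= b -> a `^ r <= b `^ r -> a <= b.
Proof.
move=> r0 a0 b0; rewrite leNgt => H; rewrite leNgt; apply: contra H => H.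
by apply: gt0_ltr_powR.
Qed.

Lemma powR_sqr r a : 0 <= a -> (a ^+ 2) `^ (r / 2) = a `^ r.
Proof.
by move=> a0; rewrite -powR_mulrn// -powRrM mulrC divfK// pnatr_eq0.
Qed.

Lemma powR_sqr_norm r a : (a ^+ 2) `^ (r / 2) = `|a| `^ r.
Proof. by rewrite -real_normK ?num_real// powR_sqr. Qed.

Lemma powR_inv r a : 0 <= a -> a^-1 `^ r = (a `^ r)^-1.
Proof.
by move=> a0; rewrite -[a^-1]powR_inv1// powRAC powR_inv1 // powR_ge0.
Qed.

Section Norms.
Variables (T : finType) (w : T -> R).
Hypothesis w_ge0 : forall x, 0 <= w x.

(** U + V is u + v times a convex combination of the normalised U / u and V / v, to which convexity
    of t^r applies pointwise. The norms enter only through upper bounds u and v, so no roots are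
    taken. *)
Lemma minkowski_sum (U V : T -> R) (u v r : R) : 1 <= r ->
  (forall x, 0 <= U x) -> (forall x, 0 <= V x) -> 0 <= u -> 0 <= v ->
  \sum_x w x * U x `^ r <= u `^ r -> \sum_x w x * V x `^ r <= v `^ r ->
  \sum_x w x * (U x + V x) `^ r <= (u + v) `^ r.
Proof.
have null (U' : T -> R) r' : 0 < r' -> (forall x, 0 <= U' x) ->
  \sum_x w x * U' x `^ r' <= 0 -> forall x, w x = 0 \/ U' x = 0.
  move=> r0 U0 H x.
  have /eqP : w x * U' x `^ r' = 0.
    apply/le_anti; rewrite mulr_ge0 ?powR_ge0// andbT; apply: le_trans H.
    rewrite (bigD1 x) //= lerDl; apply: sumr_ge0 => y _.
    by rewrite mulr_ge0 ?powR_ge0.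
  by rewrite mulf_eq0 powR_eq0 => /orP[/eqP|/andP[/eqP]]; [left|right].
move=> r1 U0 V0 u0 v0 HU HV.
have r0 : 0 < r by lra.
(* If u = 0, then U vanishes wherever the weight does not, and only V remains. *)
have [uE|un] := eqVneq u 0.
  move: HU; rewrite uE powR0 ?gt_eqF// => /null N; rewrite add0r.
  apply: le_trans HV; apply: ler_sum => x _.
  by case: (N r0 U0 x) => ->; rewrite ?mul0r // add0r.
have [vE|vn] := eqVneq v 0.
  move: HV; rewrite vE powR0 ?gt_eqF// => /null N; rewrite addr0.
  apply: le_trans HU; apply: ler_sum => x _.
  by case: (N r0 V0 x) => ->; rewrite ?mul0r // addr0.
have up : 0 < u by rewrite lt_neqAle eq_sym un.
have vp : 0 < v by rewrite lt_neqAle eq_sym vn.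
have uvp : 0 < u + v by rewrite addr_gt0.
have -> : \sum_x w x * (U x + V x) `^ r =
    (u + v) `^ r * \sum_x w x * (u / (u + v) * (U x / u) + v / (u + v) * (V x / v)) `^ r.
  rewrite mulr_sumr; apply: eq_bigr => x _.
  rewrite mulrCA -powRM; first by congr (_ * _ `^ _); field; rewrite !gt_eqF.
    exact: ltW.
  by rewrite addr_ge0 // !mulr_ge0 // ?invr_ge0 // ltW.
rewrite -[leRHS]mulr1 ler_wpM2l ?powR_ge0//.
apply: (@le_trans _ _ (\sum_x (u / (u + v) * ((u `^ r)^-1 * (w x * U x `^ r))
   + v / (u + v) * ((v `^ r)^-1 * (w x * V x `^ r))))).
  apply: ler_sum => x _.
  apply: le_trans (ler_wpM2l (w_ge0 x) (powR_convex r1 _ _ _ _ _)) _;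
    rewrite ?divr_ge0 // ?(ltW uvp) //.
    by rewrite -mulrDl mulfV // gt_eqF.
  rewrite !powRM ?invr_ge0 // !powR_inv //.
  by rewrite le_eqVlt; apply/orP; left; apply/eqP; ring.
rewrite big_split /= -!mulr_sumr.
have e1 : (u `^ r)^-1 * \sum_x w x * U x `^ r <= 1.
  by rewrite mulrC ler_pdivrMr ?powR_gt0 // mul1r.
have e2 : (v `^ r)^-1 * \sum_x w x * V x `^ r <= 1.
  by rewrite mulrC ler_pdivrMr ?powR_gt0 // mul1r.
apply: (@le_trans _ _ (u / (u + v) * 1 + v / (u + v) * 1)).
  by apply: lerD; rewrite ler_wpM2l // divr_ge0 // ltW.
by rewrite !mulr1 -mulrDl mulfV // gt_eqF.
Qed.

(** The same normalisation with concavity of t^r, which reverses the inequalities. *)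
Lemma reverse_minkowski_sum (U V : T -> R) (u v r : R) : 0 < r -> r <= 1 ->
  (forall x, 0 <= U x) -> (forall x, 0 <= V x) -> 0 <= u -> 0 <= v ->
  u `^ r <= \sum_x w x * U x `^ r -> v `^ r <= \sum_x w x * V x `^ r ->
  (u + v) `^ r <= \sum_x w x * (U x + V x) `^ r.
Proof.
move=> r0 r1 U0 V0 u0 v0 HU HV.
have [uE|un] := eqVneq u 0.
  rewrite uE add0r; apply: le_trans HV _; apply: ler_sum => x _.
  by apply: ler_wpM2l => //; apply: powR_le; rewrite ?(ltW r0)// lerDr.
have [vE|vn] := eqVneq v 0.
  rewrite vE addr0; apply: le_trans HU _; apply: ler_sum => x _.
  by apply: ler_wpM2l => //; apply: powR_le; rewrite ?(ltW r0)// lerDl.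
have up : 0 < u by rewrite lt_neqAle eq_sym un.
have vp : 0 < v by rewrite lt_neqAle eq_sym vn.
have uvp : 0 < u + v by rewrite addr_gt0.
have -> : \sum_x w x * (U x + V x) `^ r =
    (u + v) `^ r * \sum_x w x * (u / (u + v) * (U x / u) + v / (u + v) * (V x / v)) `^ r.
  rewrite mulr_sumr; apply: eq_bigr => x _.
  rewrite mulrCA -powRM; first by congr (_ * _ `^ _); field; rewrite !gt_eqF.
    exact: ltW.
  by rewrite addr_ge0 // !mulr_ge0 // ?invr_ge0 // ltW.
rewrite -[leLHS]mulr1 ler_wpM2l ?powR_ge0//.
apply: (@le_trans _ _ (\sum_x (u / (u + v) * ((u `^ r)^-1 * (w x * U x `^ r))
   + v / (u + v) * ((v `^ r)^-1 * (w x * V x `^ r))))); last first.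
  apply: ler_sum => x _.
  apply: le_trans _ (ler_wpM2l (w_ge0 x) (powR_concave r0 r1 _ _ _ _ _));
    rewrite ?divr_ge0 // ?(ltW uvp) //; last first.
    by rewrite -mulrDl mulfV // gt_eqF.
  rewrite !powRM ?invr_ge0 // !powR_inv //.
  by rewrite le_eqVlt; apply/orP; left; apply/eqP; ring.
rewrite big_split /= -!mulr_sumr.
have e1 : 1 <= (u `^ r)^-1 * \sum_x w x * U x `^ r.
  by rewrite mulrC ler_pdivlMr ?powR_gt0 // mul1r.
have e2 : 1 <= (v `^ r)^-1 * \sum_x w x * V x `^ r.
  by rewrite mulrC ler_pdivlMr ?powR_gt0 // mul1r.
apply: (@le_trans _ _ (u / (u + v) * 1 + v / (u + v) * 1)).
  by rewrite !mulr1 -mulrDl mulfV // gt_eqF.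
by apply: lerD; rewrite ler_wpM2l // divr_ge0 // ltW.
Qed.

(** Young's inequality is applied pointwise to U / u and V / v. *)
Lemma hoelder_sum (U V : T -> R) (u v p q : R) :
  0 < p -> 0 < q -> p^-1 + q^-1 = 1 ->
  (forall x, 0 <= U x) -> (forall x, 0 <= V x) -> 0 < u -> 0 < v ->
  \sum_x w x * U x `^ p <= u `^ p -> \sum_x w x * V x `^ q <= v `^ q ->
  \sum_x w x * (U x * V x) <= u * v.
Proof.
move=> p0 q0 pq U0 V0 up vp HU HV.
have -> : \sum_x w x * (U x * V x) = u * v * \sum_x w x * ((U x / u) * (V x / v)).
  rewrite mulr_sumr; apply: eq_bigr => x _; field; by rewrite !gt_eqF.
rewrite -[leRHS]mulr1 ler_wpM2l ?mulr_ge0 ?(ltW up) ?(ltW vp)//.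
apply: (@le_trans _ _ (\sum_x (p^-1 * ((u `^ p)^-1 * (w x * U x `^ p))
   + q^-1 * ((v `^ q)^-1 * (w x * V x `^ q))))).
  apply: ler_sum => x _.
  apply: le_trans (ler_wpM2l (w_ge0 x) (conjugate_powR _ _ p0 q0 pq)) _;
    rewrite ?divr_ge0 // ?(ltW up) ?(ltW vp) //.
  rewrite !powRM ?invr_ge0 ?(ltW up) ?(ltW vp) // !powR_inv ?(ltW up) ?(ltW vp)//.
  by rewrite le_eqVlt; apply/orP; left; apply/eqP; ring.
rewrite big_split /= -!mulr_sumr.
have e1 : (u `^ p)^-1 * \sum_x w x * U x `^ p <= 1.
  by rewrite mulrC ler_pdivrMr ?powR_gt0 // mul1r.
have e2 : (v `^ q)^-1 * \sum_x w x * V x `^ q <= 1.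
  by rewrite mulrC ler_pdivrMr ?powR_gt0 // mul1r.
rewrite -pq; apply: lerD; rewrite -[leRHS]mulr1 ler_wpM2l // invr_ge0 ltW //.
Qed.

End Norms.
End Powers.

(** * Two-point inequalities *)

Section TwoPoint.
Variable R : realType.
Implicit Types (a b p s x : R).

Lemma is_derive_powRD1 s (y : R) : -1 < y ->
  is_derive y 1 (fun z : R => (1 + z) `^ s) (s * (1 + y) `^ (s - 1)).
Proof.
move=> y1; have p1 : 0 < 1 + y by lra.
have g1 : is_derive y 1 (fun z : R => 1 + z) 1.
  by apply: is_derive_eq; rewrite add0r mulr1.
have := @is_derive1_comp _ (fun z : R => z `^ s) (fun z : R => 1 + z) y _ _ (is_derive1_powR s p1) g1.
by rewrite mulr1.
Qed.

Lemma is_derive_powRB1 s (y : R) : y < 1 ->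
  is_derive y 1 (fun z : R => (1 - z) `^ s) (- (s * (1 - y) `^ (s - 1))).
Proof.
move=> y1; have p1 : 0 < 1 - y by lra.
have g1 : is_derive y 1 (fun z : R => 1 - z) (-1).
  by apply: is_derive_eq; rewrite add0r mul1r.
have := @is_derive1_comp _ (fun z : R => z `^ s) (fun z : R => 1 - z) y _ _ (is_derive1_powR s p1) g1.
by rewrite mulrN1.
Qed.

(** The derivative of the difference is s ((1 + x)^(s - 1) + (1 - x)^(s - 1) - 2). The two powers
    have product (1 - x^2)^(s - 1) >= 1, so by the arithmetic-geometric mean inequality their sum is
    at least 2. *)
Lemma powR_diff_ge s x : 0 < s -> s <= 1 -> 0 <= x -> x < 1 ->
  2 * s * x <= (1 + x) `^ s - (1 - x) `^ s.
Proof.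
move=> s0 s1 x0 x1.
pose f (y : R) := (1 + y) `^ s - (1 - y) `^ s - 2 * s * y.
pose df (y : R) := s * (1 + y) `^ (s - 1) + s * (1 - y) `^ (s - 1) - 2 * s.
have fD (y : R) : -1 < y < 1 -> is_derive y 1 f (df y).
  move=> /andP[y0 y1].
  have d1 := is_derive_powRD1 s y0.
  have d2 := is_derive_powRB1 s y1.
  rewrite /f /df; apply: is_derive_eq.
  by rewrite /GRing.scale /=; ring.
have fc : {within `[0, x], continuous f}.
  apply: derivable_within_continuous => y; rewrite in_itv /= => /andP[y0 yx].
  by have [] : is_derive y 1 f (df y) by apply: fD; lra.
have fD' (y : R) : y \in `]0, x[ -> is_derive y 1 f (df y).
  by rewrite in_itv /= => /andP[? ?]; apply: fD; lra.
have [c] := MVT_segment x0 fD' fc.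
rewrite in_itv /= => /andP[c0 cx] E.
have F0 : f 0 = 0 by rewrite /f addr0 subr0 subrr mulr0 subrr.
suff : 0 <= f x by rewrite /f; lra.
rewrite F0 subr0 in E; rewrite E mulr_ge0 // ?subr0 // /df.
have H : 1 <= (1 + c) `^ (s - 1) * (1 - c) `^ (s - 1).
  have c1 : 0 <= 1 + c by lra.
  have c1' : 0 <= 1 - c by lra.
  have -> : s - 1 = - (1 - s) by ring.
  rewrite -powRM//.
  rewrite powRN invf_ge1; last by apply: powR_gt0; rewrite mulr_gt0; lra.
  rewrite -[leRHS](powRr0 ((1 + c) * (1 - c))).
  have c2 : 0 <= c ^+ 2 < 1 by rewrite sqr_ge0 /= expr_lt1 //; lra.
  have c3 : 0 < (1 + c) * (1 - c) <= 1.
    rewrite (_ : (1 + c) * (1 - c) = 1 - c ^+ 2); last by ring.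
    by lra.
  by apply: ger_powR => //; lra.
have h1 := powR_gt0 (s - 1) (_ : 0 < 1 + c).
have h2 := powR_gt0 (s - 1) (_ : 0 < 1 - c).
have {}h1 : 0 < (1 + c) `^ (s - 1) by apply: h1; lra.
have {}h2 : 0 < (1 - c) `^ (s - 1) by apply: h2; lra.
move: ((1 + c) `^ (s - 1)) ((1 - c) `^ (s - 1)) H h1 h2 => u v H u0 v0.
have uv : 2 <= u + v.
  rewrite leNgt; apply/negP => uv2.
  have : (u + v) ^+ 2 < 2 ^+ 2 by rewrite ltr_pXn2r// nnegrE; lra.
  have : 0 <= (u - v) ^+ 2 by rewrite sqr_ge0.
  by rewrite !expr2; lra.
have := mulr_ge0 (ltW s0) (_ : 0 <= u + v - 2).
by rewrite subr_ge0 => /(_ uv); lra.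
Qed.

(** Up to the factor p, nonnegativity of the derivative of the difference is the previous inequality
    with s = p - 1. The endpoint x = 1, where the base 1 - x vanishes, is left to a limit
    argument. *)
Lemma powR_sum_ge_lt p x : 1 < p -> p <= 2 -> 0 <= x -> x < 1 ->
  2 + p * (p - 1) * x ^+ 2 <= (1 + x) `^ p + (1 - x) `^ p.
Proof.
move=> p1 p2 x0 x1.
pose f (y : R) := (1 + y) `^ p + (1 - y) `^ p - p * (p - 1) * y ^+ 2.
pose df (y : R) := p * (1 + y) `^ (p - 1) - p * (1 - y) `^ (p - 1) - 2 * p * (p - 1) * y.
have fD (y : R) : -1 < y < 1 -> is_derive y 1 f (df y).
  move=> /andP[y0 y1].
  have d1 := is_derive_powRD1 p y0.
  have d2 := is_derive_powRB1 p y1.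
  rewrite /f /df; apply: is_derive_eq.
  by rewrite /GRing.scale /=; ring.
have fc : {within `[0, x], continuous f}.
  apply: derivable_within_continuous => y; rewrite in_itv /= => /andP[y0 yx].
  by have [] : is_derive y 1 f (df y) by apply: fD; lra.
have fD' (y : R) : y \in `]0, x[ -> is_derive y 1 f (df y).
  by rewrite in_itv /= => /andP[? ?]; apply: fD; lra.
have [c] := MVT_segment x0 fD' fc.
rewrite in_itv /= => /andP[c0 cx] E.
have F0 : f 0 = 2 by rewrite /f addr0 subr0 expr0n mulr0 subr0 !powR1.
suff : 0 <= f x - f 0 by rewrite F0 /f; lra.
rewrite E mulr_ge0 // ?subr0 // /df.
have := @powR_diff_ge (p - 1) c; move=> /(_ _ _ c0 _) H.
have {}H : 2 * (p - 1) * c <= (1 + c) `^ (p - 1) - (1 - c) `^ (p - 1) by apply: H; lra.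
have p0 : 0 <= p by lra.
by have := ler_wpM2l p0 H; lra.
Qed.

Lemma powR_sum_ge p x : 1 < p -> p <= 2 -> 0 <= x -> x <= 1 ->
  2 + p * (p - 1) * x ^+ 2 <= (1 + x) `^ p + (1 - x) `^ p.
Proof.
move=> p1 p2 x0; rewrite le_eqVlt => /orP[/eqP->|]; last exact: powR_sum_ge_lt.
rewrite subrr powR0; last lra.
rewrite addr0 expr1n mulr1 -[1 + 1]/(2 : R).
apply/ler_addgt0Pl => e e0.
(* Passing from 1 to 1 - d costs at most d in the power of d and 4 d in the quadratic term, hence e
   / 5. *)
pose d := Num.min (e / 5) 1.
have d0 : 0 < d by rewrite /d lt_min; lra.
have de : d <= e / 5 by rewrite /d ge_min lexx.
have d1 : d <= 1 by rewrite /d ge_min lexx orbT.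
have H := @powR_sum_ge_lt p (1 - d) p1 p2.
have {}H : 2 + p * (p - 1) * (1 - d) ^+ 2 <= (1 + (1 - d)) `^ p + (1 - (1 - d)) `^ p.
  by apply: H; lra.
have h1 : (1 + (1 - d)) `^ p <= 2 `^ p by apply: powR_le; lra.
have h2 : (1 - (1 - d)) `^ p <= d.
  rewrite (_ : 1 - (1 - d) = d); last by ring.
  by apply: ge1r_powR; lra.
have pp : 0 <= p * (p - 1) <= 2.
  have k1 : 0 <= p * (p - 1) by rewrite mulr_ge0; lra.
  have k2 : 0 <= (2 - p) * (p + 1) by rewrite mulr_ge0; lra.
  by apply/andP; split; lra.
have : p * (p - 1) * (1 - d) ^+ 2 >= p * (p - 1) - 4 * d.
  have : 0 <= p * (p - 1) * d ^+ 2 by rewrite mulr_ge0 ?sqr_ge0//; lra.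
  move: (p * (p - 1)) pp => k pp.
  have : k * d <= 2 * d by rewrite ler_wpM2r //; lra.
  rewrite !expr2; lra.
by lra.
Qed.

(** Young's inequality for (1 + x)^s and 1 with the exponents 1 / s and 1 / (1 - s). *)
Lemma powR_bernoulli s x : 0 <= s -> s <= 1 -> 0 <= x -> (1 + x) `^ s <= 1 + s * x.
Proof.
move=> s0 s1 x0.
have x1 : 0 <= 1 + x by lra.
have [->|sn] := eqVneq s 0; first by rewrite powRr0 mul0r addr0.
have [->|s1n] := eqVneq s 1; first by rewrite powRr1// mul1r.
have sp : 0 < s by rewrite lt_neqAle eq_sym sn.
have sp1 : s < 1 by rewrite lt_neqAle s1n.
have := @conjugate_powR R ((1 + x) `^ s) 1 s^-1 (1 - s)^-1 (powR_ge0 _ _) ler01.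
rewrite !invr_gt0 !invrK subr_gt0 -powRrM mulfV// powRr1// powR1 mulr1.
by move=> /(_ sp sp1); rewrite subrKC => /(_ erefl); lra.
Qed.

(** The value 1 + p (p - 1) x^2 / 2 lies between the two sides: Bernoulli's inequality, with p / 2
    <= 1, handles the left and the second-order bound the right. *)
Lemma two_point_lt p x : 1 < p -> p <= 2 -> 0 <= x -> x <= 1 ->
  (1 + (p - 1) * x ^+ 2) `^ (p / 2) <= ((1 + x) `^ p + (1 - x) `^ p) / 2.
Proof.
move=> p1 p2 x0 x1.
have H0 : 0 <= (p - 1) * x ^+ 2 by rewrite mulr_ge0 ?sqr_ge0//; lra.
apply: (@le_trans _ _ (1 + p / 2 * ((p - 1) * x ^+ 2))).
  by apply: powR_bernoulli => //; lra.
by have := powR_sum_ge p1 p2 x0 x1; lra.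
Qed.

(** By homogeneity the one-variable inequality at x = d / c settles 0 <= d <= c; signs and order are
    then removed by symmetry. *)
Lemma two_point_real p a b : 1 < p -> p <= 2 ->
  (a ^+ 2 + (p - 1) * b ^+ 2) `^ (p / 2) <= (`|a + b| `^ p + `|a - b| `^ p) / 2.
Proof.
move=> p1 p2.
have H : forall c d : R,  0 <= d -> d <= c ->
   (c ^+ 2 + (p - 1) * d ^+ 2) `^ (p / 2) <= (`|c + d| `^ p + `|c - d| `^ p) / 2.
  move=> c d d0 dc; have c0 := le_trans d0 dc.
  have [cE|cn] := eqVneq c 0.
    have dE : d = 0 by apply/le_anti; rewrite d0 -cE dc.
    rewrite cE dE addr0 subrr normr0 expr0n mulr0 addr0 !powR0; lra.
  have cp : 0 < c by rewrite lt_neqAle eq_sym cn.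
  have e1 : c ^+ 2 + (p - 1) * d ^+ 2 = c ^+ 2 * (1 + (p - 1) * (d / c) ^+ 2) by field.
  have e2 : `|c + d| = c * (1 + d / c) by rewrite ger0_norm ?addr_ge0//; field.
  have e3 : `|c - d| = c * (1 - d / c) by rewrite ger0_norm ?subr_ge0//; field.
  have x0 : 0 <= d / c by rewrite divr_ge0.
  have x1 : d / c <= 1 by rewrite ler_pdivrMr ?mul1r.
  have H1 := two_point_lt p1 p2 x0 x1.
  have pos : 0 <= 1 + (p - 1) * (d / c) ^+ 2.
    by rewrite addr_ge0// mulr_ge0 ?sqr_ge0//; lra.
  rewrite e1 e2 e3 (powRM _ (sqr_ge0 c) pos) powR_sqr// !powRM//; try lra.
  by have := ler_wpM2l (powR_ge0 c p) H1; rewrite [X in _ <= X]mulrA [X in _ <= X / _]mulrDr.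
(* When |c| < |d|, exchanging the two entries can only raise the left side, because p - 1 <= 1. *)
have K : forall c d : R,  (c ^+ 2 + (p - 1) * d ^+ 2) `^ (p / 2) <=
     (`| `|c| + `|d| | `^ p + `| `|c| - `|d| | `^ p) / 2.
  move=> c d; case: (leP `|d| `|c|) => [dc|/ltW cd].
    by apply: le_trans (H _ _ (normr_ge0 d) dc); rewrite !real_normK ?num_real.
  have := H _ _ (normr_ge0 c) cd; rewrite !real_normK ?num_real//.
  rewrite (addrC `|d|) (distrC `|d|) => H'; apply: le_trans H'.
  apply: powR_le; [lra| |].
    by rewrite addr_ge0 ?sqr_ge0// mulr_ge0 ?sqr_ge0//; lra.
  have c2d2 : 0 <= d ^+ 2 - c ^+ 2 by rewrite subr_ge0 -(real_normK (num_real c)) -(real_normK (num_real d)) lerXn2r ?nnegrE.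
  have : 0 <= (2 - p) * (d ^+ 2 - c ^+ 2) by rewrite mulr_ge0//; lra.
  by lra.
apply: le_trans (K a b) _.
rewrite le_eqVlt; apply/orP; left; apply/eqP; congr (_ / _).
have [a0|a0] := lerP 0 a; have [b0|b0] := lerP 0 b.
- by rewrite (ger0_norm a0) (ger0_norm b0).
- by rewrite (ger0_norm a0) (ltr0_norm b0) opprK [LHS]addrC.
- rewrite (ltr0_norm a0) (ger0_norm b0) [LHS]addrC; congr (_ `^ _ + _ `^ _).
    by rewrite -normrN opprD !opprK.
  by rewrite -normrN opprD !opprK.
- rewrite (ltr0_norm a0) (ltr0_norm b0); congr (_ `^ _ + _ `^ _).
    by rewrite -normrN opprD !opprK.
  by rewrite -normrN opprD !opprK.
Qed.
End TwoPoint.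

(** * Two-point inequality for complex values *)

Section TwoPointComplex.
Variable R : realType.
Implicit Types (a b y : R).

Let half_sumE a b : (a + b) / 2 = 1 / 2 * a + 1 / 2 * b.
Proof. by field. Qed.

(* Duality with two_point_real: test against the sign-preserving power
   h = sgn(g) |g|^(q-1) of g = a +- y b. *)
Lemma two_point_dual y a b : 0 < y -> y <= 1 ->
  (`|a + y * b| `^ (1 + y ^- 2) + `|a - y * b| `^ (1 + y ^- 2)) / 2
    <= (a ^+ 2 + b ^+ 2) `^ ((1 + y ^- 2) / 2).
Proof.
move=> y0 y1; set q := 1 + y ^- 2; pose p := 1 + y ^+ 2.
have y2 : 0 < y ^+ 2 by rewrite exprn_gt0.
have y21 : y ^+ 2 <= 1 by rewrite expr_le1 // ltW.
have q0 : 0 < q by rewrite /q addr_gt0 ?invr_gt0.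
have q1 : 0 < q - 1 by rewrite /q addrAC subrr add0r invr_gt0.
have p0 : 0 < p by rewrite /p; lra.
have qp : (q - 1) * p = q by rewrite /q /p; field; rewrite gt_eqF.
pose h (g : R) := Num.sg g * `|g| `^ (q - 1).
have gh g : g * h g = `|g| `^ q.
  rewrite /h mulrA mulrC -[in X in _ * X](mulrC (Num.sg g)) -normrEsg mulrC.
  by rewrite mulr_powRB1.
have hp g : `|h g| `^ p = `|g| `^ q.
  have [->|gn] := eqVneq g 0.
    by rewrite /h sgr0 mul0r normr0 !powR0 // gt_eqF.
  rewrite /h normrM normr_sg gn mul1r ger0_norm ?powR_ge0//.
  by rewrite -powRrM qp.
set X := (_ + _) / 2.
pose h1 := h (a + y * b); pose h2 := h (a - y * b).
pose al := (h1 + h2) / 2; pose be := (h1 - h2) / 2.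
have XE : X = a * al + y * b * be.
  by rewrite /X -!gh -/h1 -/h2 /al /be; field.
have H : (al ^+ 2 + y ^+ 2 * be ^+ 2) `^ (p / 2) <= X.
  have := @two_point_real R p al be; rewrite (_ : p - 1 = y ^+ 2); last by rewrite /p; ring.
  have -> : al + be = h1 by rewrite /al /be; field.
  have -> : al - be = h2 by rewrite /al /be; field.
  by rewrite !hp; apply; rewrite /p; lra.
have X0 : 0 <= X by rewrite /X divr_ge0 // addr_ge0 ?powR_ge0.
have [->|Xn] := eqVneq X 0; first exact: powR_ge0.
have Xp : 0 < X by rewrite lt_neqAle eq_sym Xn.
(* Cauchy-Schwarz for the pairing of (a, b) with (al, y be). Since 1 / p + 1 / q = 1, a factor X^(2
   / p) cancels from X^2 below. *)
have CS : X ^+ 2 <= (a ^+ 2 + b ^+ 2) * (al ^+ 2 + y ^+ 2 * be ^+ 2).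
  rewrite XE -subr_ge0 (_ : _ - _ = (y * a * be - b * al) ^+ 2) ?sqr_ge0//; ring.
have M0 : 0 <= al ^+ 2 + y ^+ 2 * be ^+ 2 by rewrite -exprMn addr_ge0 ?sqr_ge0.
have D0 : 0 <= a ^+ 2 + b ^+ 2 by rewrite addr_ge0 ?sqr_ge0.
have HM : al ^+ 2 + y ^+ 2 * be ^+ 2 <= X `^ (2 / p).
  apply: (@powR_le_inv _ (p / 2)); rewrite ?divr_gt0 ?powR_ge0//.
  by rewrite -powRrM (_ : 2 / p * (p / 2) = 1) ?powRr1//; field; rewrite gt_eqF.
have X2 : X ^+ 2 = X `^ (2 / p) * X `^ (2 / q).
  rewrite -powRD; last by rewrite Xn implybT.
  rewrite (_ : 2 / p + 2 / q = 2%:R) ?powR_mulrn//.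
  by rewrite /p /q; field; rewrite !gt_eqF // addr_gt0.
have : X `^ (2 / p) * X `^ (2 / q) <= X `^ (2 / p) * (a ^+ 2 + b ^+ 2).
  by rewrite -X2 (le_trans CS)// mulrC ler_wpM2r.
rewrite ler_pM2l ?powR_gt0// => HX.
apply: (@powR_le_inv _ (2 / q)); rewrite ?divr_gt0 ?powR_ge0//.
by rewrite -powRrM (_ : q / 2 * (2 / q) = 1) ?powRr1//; field; rewrite gt_eqF.
Qed.

(** Minkowski in L^(q / 2) for the squares, where q / 2 >= 1 because y <= 1: the constant square (y
    ga)^2 splits off and [two_point_dual] bounds the rest. *)
Lemma two_point_upper y (al si ga : R) : 0 < y -> y <= 1 ->
  (((al + y * si) ^+ 2 + (y * ga) ^+ 2) `^ ((1 + y ^- 2) / 2)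
   + ((al - y * si) ^+ 2 + (y * ga) ^+ 2) `^ ((1 + y ^- 2) / 2)) / 2
   <= (al ^+ 2 + si ^+ 2 + (y * ga) ^+ 2) `^ ((1 + y ^- 2) / 2).
Proof.
move=> y0 y1; set q := 1 + y ^- 2.
have y2 : 0 < y ^+ 2 by rewrite exprn_gt0.
have qr : 1 <= q / 2.
  by rewrite ler_pdivlMr// mul1r /q -[2]/(1 + 1) lerD2l invf_ge1// expr_le1 // ltW.
have half0 : 0 <= (1 / 2 : R) by lra.
have := @minkowski_sum R bool (fun _ : bool => 1 / 2 : R) (fun _ => half0)
  (fun b : bool => (if b then al + y * si else al - y * si) ^+ 2)
  (fun _ : bool => (y * ga) ^+ 2) (al ^+ 2 + si ^+ 2) ((y * ga) ^+ 2) (q / 2) qr.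
rewrite !big_bool /= => H.
rewrite [leLHS]half_sumE.
apply: H.
- by move=> b; rewrite sqr_ge0.
- by move=> b; rewrite sqr_ge0.
- by rewrite addr_ge0 ?sqr_ge0.
- by rewrite sqr_ge0.
- rewrite !powR_sqr_norm -[leLHS]half_sumE; exact: two_point_dual.
- by rewrite -mulrDl; lra.
Qed.

(** Here p / 2 <= 1, so the reverse Minkowski inequality splits off si^2 and [two_point_real] bounds
    the rest from below. *)
Lemma two_point_lower y (al si ga : R) : 0 < y -> y <= 1 ->
  (al ^+ 2 + si ^+ 2 + (y * ga) ^+ 2) `^ ((1 + y ^+ 2) / 2) <=
  (((al + ga) ^+ 2 + si ^+ 2) `^ ((1 + y ^+ 2) / 2)
   + ((al - ga) ^+ 2 + si ^+ 2) `^ ((1 + y ^+ 2) / 2)) / 2.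
Proof.
move=> y0 y1; set p := 1 + y ^+ 2.
have y2 : 0 < y ^+ 2 by rewrite exprn_gt0.
have y21 : y ^+ 2 <= 1 by rewrite expr_le1 // ltW.
have half0 : 0 <= (1 / 2 : R) by lra.
have := @reverse_minkowski_sum R bool (fun _ : bool => 1 / 2 : R) (fun _ => half0)
  (fun b : bool => (if b then al + ga else al - ga) ^+ 2)
  (fun _ : bool => si ^+ 2) (al ^+ 2 + y ^+ 2 * ga ^+ 2) (si ^+ 2) (p / 2).
rewrite !big_bool /= => H.
rewrite [leRHS]half_sumE.
have -> : al ^+ 2 + si ^+ 2 + (y * ga) ^+ 2 = al ^+ 2 + y ^+ 2 * ga ^+ 2 + si ^+ 2.
  by ring.
apply: H.
- by rewrite /p; lra.
- by rewrite /p; lra.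
- by move=> b; rewrite sqr_ge0.
- by move=> b; rewrite sqr_ge0.
- by rewrite -exprMn addr_ge0 ?sqr_ge0.
- by rewrite sqr_ge0.
- rewrite !powR_sqr_norm -[leRHS]half_sumE.
  have := @two_point_real R p al ga.
  rewrite (_ : p - 1 = y ^+ 2); last by rewrite /p; ring.
  by apply; rewrite /p; lra.
- by rewrite -mulrDl; lra.
Qed.

(* After a rotation a is real: al = |a|, and ga, si are the components of b
   along and across a.  Minkowski's inequality splits off the component that
   does not interact with a, leaving the real two-point inequalities. *)
Lemma two_point_plane y (a1 a2 b1 b2 : R) : 0 < y -> y <= 1 ->
  (((a1 - y * b2) ^+ 2 + (a2 + y * b1) ^+ 2) `^ ((1 + y ^- 2) / 2)
   + ((a1 + y * b2) ^+ 2 + (a2 - y * b1) ^+ 2) `^ ((1 + y ^- 2) / 2)) / 2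
   <= ((((a1 + b1) ^+ 2 + (a2 + b2) ^+ 2) `^ ((1 + y ^+ 2) / 2)
   + ((a1 - b1) ^+ 2 + (a2 - b2) ^+ 2) `^ ((1 + y ^+ 2) / 2)) / 2) `^ (y ^- 2).
Proof.
move=> y0 y1; set q := 1 + y ^- 2; pose p := 1 + y ^+ 2; rewrite -/p.
have y2 : 0 < y ^+ 2 by rewrite exprn_gt0.
have y21 : y ^+ 2 <= 1 by rewrite expr_le1 // ltW.
have q0 : 0 < q by rewrite /q addr_gt0 ?invr_gt0.
have p0 : 0 < p by rewrite /p; lra.
have qp : p / 2 * y ^- 2 = q / 2 by rewrite /q /p; field; rewrite gt_eqF.
(* The chain of the two bounds needs only al, si, ga that reproduce the four squared moduli. *)
have step al si ga : ((al + y * si) ^+ 2 + (y * ga) ^+ 2 = (a1 + y * b2) ^+ 2 + (a2 - y * b1) ^+ 2) ->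
  ((al - y * si) ^+ 2 + (y * ga) ^+ 2 = (a1 - y * b2) ^+ 2 + (a2 + y * b1) ^+ 2) ->
  (al + ga) ^+ 2 + si ^+ 2 = (a1 + b1) ^+ 2 + (a2 + b2) ^+ 2 ->
  (al - ga) ^+ 2 + si ^+ 2 = (a1 - b1) ^+ 2 + (a2 - b2) ^+ 2 ->
  (((a1 - y * b2) ^+ 2 + (a2 + y * b1) ^+ 2) `^ (q / 2)
   + ((a1 + y * b2) ^+ 2 + (a2 - y * b1) ^+ 2) `^ (q / 2)) / 2
   <= ((((a1 + b1) ^+ 2 + (a2 + b2) ^+ 2) `^ (p / 2)
   + ((a1 - b1) ^+ 2 + (a2 - b2) ^+ 2) `^ (p / 2)) / 2) `^ (y ^- 2).
  move=> <- <- <- <-; rewrite addrC; apply: le_trans (two_point_upper al si ga y0 y1) _.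
  rewrite -/q -qp powRrM; apply: powR_le; rewrite ?invr_ge0 ?powR_ge0 ?(ltW y2)//.
  exact: two_point_lower.
(* For a = 0 there is no direction to rotate to; all of b is put into ga. *)
have [A0|An] := eqVneq (a1 ^+ 2 + a2 ^+ 2) 0.
  have [e1 e2] : a1 = 0 /\ a2 = 0.
    by move/eqP: A0; rewrite paddr_eq0 ?sqr_ge0// !sqrf_eq0 => /andP[/eqP-> /eqP->].
  pose B := Num.sqrt (b1 ^+ 2 + b2 ^+ 2).
  have BE : B ^+ 2 = b1 ^+ 2 + b2 ^+ 2 by rewrite sqr_sqrtr ?addr_ge0 ?sqr_ge0.
  apply: (step 0 0 B); rewrite e1 e2.
  - by rewrite [LHS](_ : _ = y ^+ 2 * B ^+ 2); [rewrite BE; ring | ring].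
  - by rewrite [LHS](_ : _ = y ^+ 2 * B ^+ 2); [rewrite BE; ring | ring].
  - by rewrite [LHS](_ : _ = B ^+ 2); [rewrite BE; ring | ring].
  - by rewrite [LHS](_ : _ = B ^+ 2); [rewrite BE; ring | ring].
have Ap : 0 < a1 ^+ 2 + a2 ^+ 2 by rewrite lt_neqAle eq_sym An addr_ge0 ?sqr_ge0.
pose al := Num.sqrt (a1 ^+ 2 + a2 ^+ 2).
have alE : al ^+ 2 = a1 ^+ 2 + a2 ^+ 2 by rewrite sqr_sqrtr ?ltW.
have al0 : 0 < al by rewrite sqrtr_gt0.
(* The scalar and cross products of a and b, which divided by al give ga and si. *)
pose c := a1 * b1 + a2 * b2; pose s := a1 * b2 - a2 * b1.
have cs : (c / al) ^+ 2 + (s / al) ^+ 2 = b1 ^+ 2 + b2 ^+ 2.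
  rewrite !expr_div_n -mulrDl alE /c /s; field; exact: lt0r_neq0.
have ca : al * (c / al) = c by field; rewrite gt_eqF.
have sa : al * (s / al) = s by field; rewrite gt_eqF.
move: (s / al) (c / al) cs ca sa => si ga cs ca sa.
apply: (step al si ga).
- have -> : (al + y * si) ^+ 2 + (y * ga) ^+ 2
    = al ^+ 2 + 2 * y * (al * si) + y ^+ 2 * (ga ^+ 2 + si ^+ 2) by ring.
  rewrite cs sa alE /s; ring.
- have -> : (al - y * si) ^+ 2 + (y * ga) ^+ 2
    = al ^+ 2 - 2 * y * (al * si) + y ^+ 2 * (ga ^+ 2 + si ^+ 2) by ring.
  rewrite cs sa alE /s; ring.
- have -> : (al + ga) ^+ 2 + si ^+ 2
    = al ^+ 2 + 2 * (al * ga) + (ga ^+ 2 + si ^+ 2) by ring.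
  rewrite cs ca alE /c; ring.
- have -> : (al - ga) ^+ 2 + si ^+ 2
    = al ^+ 2 - 2 * (al * ga) + (ga ^+ 2 + si ^+ 2) by ring.
  rewrite cs ca alE /c; ring.
Qed.

End TwoPointComplex.

(** * Beckner's inequality on the cube *)

Section Tensor.
Import ComplexField.Normc.
Local Open Scope complex_scope.
Variable R : realType.
Local Notation C := R[i].
Implicit Types (y : R).

Lemma normc_sq (z : C) : normc z ^+ 2 = complex.Re z ^+ 2 + complex.Im z ^+ 2.
Proof. by case: z => a b /=; rewrite sqr_sqrtr // addr_ge0 ?sqr_ge0. Qed.

Lemma normc_ge0 (z : C) : 0 <= normc z.
Proof. by case: z => a b /=; rewrite sqrtr_ge0. Qed.

Lemma normc_powR (z : C) r :
  normc z `^ r = (complex.Re z ^+ 2 + complex.Im z ^+ 2) `^ (r / 2).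
Proof. by rewrite -normc_sq powR_sqr // normc_ge0. Qed.

Lemma two_point_complex y (a b : C) : 0 < y -> y <= 1 ->
  (normc (a + (0 +i* y) * b) `^ (1 + y ^- 2)
   + normc (a - (0 +i* y) * b) `^ (1 + y ^- 2)) / 2 <=
  ((normc (a + b) `^ (1 + y ^+ 2) + normc (a - b) `^ (1 + y ^+ 2)) / 2) `^ (y ^- 2).
Proof.
move=> y0 y1; case: a b => [a1 a2] [b1 b2]; rewrite !normc_powR /=.
apply: le_trans (two_point_plane a1 a2 b1 b2 y0 y1).
by rewrite !mul0r !add0r opprK.
Qed.

Definition bcons n (b : bool) (x : cube n) : cube n.+1 :=
  [ffun i => if unlift ord0 i is Some j then x j else b].

Lemma bcons0 n b (x : cube n) : bcons b x ord0 = b.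
Proof. by rewrite ffunE unlift_none. Qed.

Lemma bconsS n b (x : cube n) j : bcons b x (lift ord0 j) = x j.
Proof. by rewrite ffunE liftK. Qed.

Lemma big_cubeS (V : nmodType) n (F : cube n.+1 -> V) :
  \sum_x F x = \sum_(b : bool) \sum_(x : cube n) F (bcons b x).
Proof.
rewrite pair_big /= (reindex (fun p : bool * cube n => bcons p.1 p.2)) //=.
exists (fun x : cube n.+1 => (x ord0, [ffun j => x (lift ord0 j)])) => [[b x] _|x _] /=.
  rewrite bcons0; congr pair; apply/ffunP => j; by rewrite ffunE bconsS.
apply/ffunP => i; case: (unliftP ord0 i) => [j ->|->]; last by rewrite bcons0.
by rewrite bconsS ffunE.
Qed.

(** The kernel of T_{iy}: expanding the product over subsets shows that it multiplies each Walsh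
    function of level k by (iy)^k. *)
Definition kern y n (x x' : cube n) : C :=
  \prod_i (1 +i* (y * (coord R x i * coord R x' i))).

Definition Tnoise y n (f : cube n -> C) (x : cube n) : C :=
  (2 ^- n)%:C * \sum_x' kern y x x' * f x'.

Lemma kernS y n b b' (x x' : cube n) :
  kern y (bcons b x) (bcons b' x') = (1 +i* (y * ((-1) ^+ b * (-1) ^+ b'))) * kern y x x'.
Proof.
rewrite /kern big_ord_recl /coord !bcons0; congr (_ * _).
by apply: eq_bigr => i _; rewrite !bconsS.
Qed.

(** u and v are the even and odd parts in the first coordinate, and only the odd part picks up the
    factor iy. This is the shape to which the two-point inequality applies. *)
Lemma TnoiseS y n (f : cube n.+1 -> C) b (x : cube n) :
  let g b' := Tnoise y (fun x' => f (bcons b' x')) x in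
  let u := (2^-1)%:C * (g false + g true) in
  let v := (2^-1)%:C * (g false - g true) in
  Tnoise y f (bcons b x) = u + (-1) ^+ b * ((0 +i* y) * v).
Proof.
move=> g u v.
rewrite /Tnoise big_cubeS /= big_bool /=.
under eq_bigr do rewrite kernS -mulrA.
under [X in _ + X]eq_bigr do rewrite kernS -mulrA.
rewrite -!mulr_sumr.
have -> : (2 ^- n.+1)%:C = (2^-1)%:C * (2 ^- n)%:C :> C.
  by rewrite -rmorphM /= exprS invfM.
rewrite -mulrA mulrDr ![(2 ^- n)%:C * (_ * _)]mulrCA.
rewrite -/(Tnoise _ _ _) -/(g true) -[X in _ + _ * X]/(g false).
have E c : 1 +i* (y * c) = 1 + (0 +i* y) * c%:C :> C.
  by apply/eqP; rewrite eq_complex /= !(mul0r, mulr0, oppr0, addr0, add0r) !eqxx.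
rewrite /u /v !E; case: b; rewrite /= !(expr0, expr1, mulr1, mul1r, mulrNN, mulN1r) !rmorphN !rmorph1; ring.
Qed.

Let halfCE : (2^-1)%:C = 2^-1 :> C.
Proof. by rewrite fmorphV rmorph_nat. Qed.

Lemma halfCD (z w : C) : (2^-1)%:C * (z + w) + (2^-1)%:C * (z - w) = z.
Proof. by rewrite halfCE; field. Qed.

Lemma halfCB (z w : C) : (2^-1)%:C * (z + w) - (2^-1)%:C * (z - w) = w.
Proof. by rewrite halfCE; field. Qed.

(** The p-th power of the norm, without the root, so that adding a coordinate simply averages two
    values. *)
Definition pmean n p (f : cube n -> C) : R :=
  2 ^- n * \sum_x normc (f x) `^ p.

Lemma pmean_ge0 n p (f : cube n -> C) : 0 <= pmean p f.
Proof.
by rewrite mulr_ge0 ?invr_ge0 ?exprn_ge0// sumr_ge0// => x _; rewrite powR_ge0.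
Qed.

Lemma pmeanS n p (f : cube n.+1 -> C) :
  pmean p f = (pmean p (fun x => f (bcons false x)) + pmean p (fun x => f (bcons true x))) / 2.
Proof.
by rewrite /pmean big_cubeS big_bool /= exprS invfM; field; rewrite expf_neq0 //= pnatr_eq0.
Qed.

(** Beckner's inequality raised to the power q, with q / p = y^-2. Induction on n: the two-point
    inequality acts in the new coordinate, and Minkowski's inequality with exponent q / p >= 1
    recombines the inductive bounds for the two halves. *)
Lemma Tnoise_contract y n (f : cube n -> C) : 0 < y -> y <= 1 ->
  pmean (1 + y ^- 2) (Tnoise y f) <= pmean (1 + y ^+ 2) f `^ (y ^- 2).
Proof.
move=> y0 y1; set q := 1 + y ^- 2; set p := 1 + y ^+ 2.
have y2 : 0 < y ^+ 2 by rewrite exprn_gt0.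
have y21 : y ^+ 2 <= 1 by rewrite expr_le1 // ltW.
have qp (z : R) : (z `^ p) `^ (y ^- 2) = z `^ q.
  by rewrite -powRrM /p /q mulrDl mul1r mulfV ?gt_eqF// addrC.
elim: n f => [|n IH] f.
  have E (F : cube 0 -> C) r : pmean r F = normc (F [ffun=> false]) `^ r.
    rewrite /pmean expr0 invr1 mul1r (bigD1 [ffun=> false]) //= big1 ?addr0//.
    by move=> x /eqP[]; apply/ffunP => -[].
  rewrite !E qp /Tnoise expr0 invr1 mul1r (bigD1 [ffun=> false]) //= big1 ?addr0; last first.
    by move=> x /eqP[]; apply/ffunP => -[].
  by rewrite /kern big_ord0 mul1r.
pose g b := Tnoise y (fun x' => f (bcons b x')).
have wn : 0 <= 2 ^- n :> R by rewrite invr_ge0 exprn_ge0.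
have step : pmean q (Tnoise y f) <=
   \sum_x 2 ^- n * (normc (g false x) `^ p / 2 + normc (g true x) `^ p / 2) `^ (y ^- 2).
  rewrite pmeanS /pmean -mulrDr -big_split /= mulr_sumr mulr_suml.
  apply: ler_sum => x _; rewrite -mulrA; apply: ler_wpM2l => //.
  rewrite !TnoiseS /= expr0 mul1r mulN1r.
  apply: le_trans (two_point_complex _ _ y0 y1) _.
  by rewrite halfCD halfCB -/p -mulrDl /g.
apply: le_trans step _.
have half b : \sum_x 2 ^- n * (normc (g b x) `^ p / 2) `^ (y ^- 2) <=
    (pmean p (fun x => f (bcons b x)) / 2) `^ (y ^- 2).
  rewrite powRM ?pmean_ge0// ?invr_ge0//.
  have := ler_wpM2r (powR_ge0 2^-1 (y ^- 2)) (IH (fun x => f (bcons b x))).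
  apply: le_trans; rewrite -/q /pmean mulrAC mulr_sumr.
  rewrite le_eqVlt; apply/orP; left; apply/eqP; apply: eq_bigr => x _.
  by rewrite powRM ?powR_ge0 ?invr_ge0// qp mulrA mulrAC.
rewrite pmeanS mulrDl.
apply: (minkowski_sum (fun=> wn)).
- by rewrite invf_ge1.
- by move=> x; rewrite divr_ge0 ?powR_ge0.
- by move=> x; rewrite divr_ge0 ?powR_ge0.
- by rewrite divr_ge0 ?pmean_ge0.
- by rewrite divr_ge0 ?pmean_ge0.
- exact: half.
- exact: half.
Qed.

End Tensor.

(** * Walsh energy on the imaginary axis *)

Section Energy.
Import ComplexField.Normc.
Local Open Scope complex_scope.
Variable R : realType.
Local Notation C := R[i].
Implicit Types (y t : R).

Lemma normcR (x : R) : normc x%:C = `|x|.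
Proof. by rewrite /= expr0n addr0 sqrtr_sqr. Qed.

Lemma normc_sum (T : finType) (F : T -> C) :
  normc (\sum_x F x) <= \sum_x normc (F x).
Proof.
elim/big_ind2: _ => [|a b c d ab cd|//]; first by rewrite normc0.
by apply: le_trans (le_normcD _ _) _; apply: lerD.
Qed.

(** The polynomial P(u) = E[f T_u f]; the argument is complex because P is bounded on the imaginary
    axis and evaluated at 1. *)
Definition wenergy n (f : cube n -> R) (u : C) : C :=
  \sum_(S : {set 'I_n}) u ^+ #|S| * (fourier f S ^+ 2)%:C.

Lemma kernE y n (x x' : cube n) :
  kern y x x' = \sum_(S : {set 'I_n}) (0 +i* y) ^+ #|S| * (walsh R S x * walsh R S x')%:C.
Proof.
have E c : 1 +i* (y * c) = (0 +i* y) * c%:C + 1 :> C.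
  by apply/eqP; rewrite eq_complex /= !(mul0r, mulr0, oppr0, addr0, add0r) !eqxx.
rewrite /kern (eq_bigr _ (fun i _ => E _)) bigA_distr; apply: eq_bigr => S _.
rewrite -big_mkcond big_split /= prodr_const; congr (_ * _).
by rewrite /walsh -big_split /= rmorph_prod.
Qed.

Lemma wenergyE y n (f : cube n -> R) :
  wenergy f (0 +i* y) = (2 ^- n)%:C * \sum_x (f x)%:C * Tnoise y (fun x => (f x)%:C) x.
Proof.
rewrite /wenergy /Tnoise.
under [X in _ = _ * X]eq_bigr => x _.
  rewrite mulrCA mulr_sumr.
  under eq_bigr => x' _ do rewrite kernE mulr_suml mulr_sumr.
  rewrite exchange_big /= mulr_sumr; over.
rewrite exchange_big /= mulr_sumr; apply: eq_bigr => S _.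
rewrite -mulr_sumr.
have -> : (fourier f S ^+ 2)%:C = (2 ^- n)%:C * (2 ^- n)%:C *
    ((\sum_x f x * walsh R S x)%:C * (\sum_x f x * walsh R S x)%:C) :> C.
  by rewrite /fourier -!rmorphM /=; congr (_%:C); ring.
rewrite [LHS]mulrCA -!mulrA; congr (_ * _); congr (_ * _).
rewrite !rmorph_sum /= mulr_suml mulr_sumr; apply: eq_bigr => x _.
rewrite !mulr_sumr; apply: eq_bigr => x' _; rewrite !rmorphM /=; ring.
Qed.

(** Hoelder's inequality for f against T_{iy} f with the conjugate exponents p and q, followed by
    the contraction from L^p to L^q; each factor is at most the p-norm. *)
Lemma wenergy_le_pmean y n (f : cube n -> R) : 0 < y -> y <= 1 ->
  0 < pmean (1 + y ^+ 2) (fun x => (f x)%:C) ->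
  normc (wenergy f (0 +i* y)) <=
  pmean (1 + y ^+ 2) (fun x => (f x)%:C) `^ (2 / (1 + y ^+ 2)).
Proof.
move=> y0 y1; set m := pmean _ _ => m0.
have y2 : 0 < y ^+ 2 by rewrite exprn_gt0.
pose p := 1 + y ^+ 2; pose q := 1 + y ^- 2; rewrite -/p.
have p0 : 0 < p by rewrite /p addr_gt0.
have q0 : 0 < q by rewrite /q addr_gt0 // invr_gt0.
have pqE : p^-1 * q = y ^- 2.
  by rewrite /p /q; field; rewrite gt_eqF // gt_eqF // addr_gt0.
have wn : 0 <= 2 ^- n :> R by rewrite invr_ge0 exprn_ge0.
have -> : m `^ (2 / p) = m `^ p^-1 * m `^ p^-1.
  rewrite -powRD; last by rewrite (gt_eqF m0) implybT.
  by rewrite (_ : 2 / p = p^-1 + p^-1) //; field; rewrite gt_eqF.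
rewrite wenergyE normcM normcR ger0_norm// .
apply: (@le_trans _ _ (\sum_x 2 ^- n * (`|f x| * normc (Tnoise y (fun x => (f x)%:C) x)))).
  rewrite -mulr_sumr ler_wpM2l //; apply: le_trans (normc_sum _) _.
  by apply: ler_sum => x _; rewrite normcM normcR.
have mp := powR_gt0 p^-1 m0.
apply: (hoelder_sum (fun=> wn) p0 q0) => //.
- by rewrite /p /q; field; rewrite !gt_eqF // addr_gt0.
- by move=> x; rewrite normc_ge0.
- have -> : (m `^ p^-1) `^ p = m by rewrite -powRrM mulVf ?gt_eqF// powRr1// ltW.
  rewrite /m /pmean mulr_sumr.
  by apply: ler_sum => x _; rewrite normcR.
- rewrite -powRrM pqE; have := @Tnoise_contract R y n (fun x => (f x)%:C) y0 y1.
  by rewrite /pmean -mulr_sumr.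
Qed.

(** Hoelder's inequality for |f|^(1 + t) = |f|^(1 - t) (f^2)^t with the exponents 1 / (1 - t) and 1
    / t. *)
Lemma pmean_log_convex t n (f : cube n -> R) : 0 < t -> t < 1 ->
  0 < 2 ^- n * \sum_x `|f x| -> 0 < 2 ^- n * \sum_x f x ^+ 2 ->
  pmean (1 + t) (fun x => (f x)%:C) <=
  (2 ^- n * \sum_x `|f x|) `^ (1 - t) * (2 ^- n * \sum_x f x ^+ 2) `^ t.
Proof.
move=> t0 t1 A0 B0.
have wn : 0 <= 2 ^- n :> R by rewrite invr_ge0 exprn_ge0.
have s0 : 0 < 1 - t by rewrite subr_gt0.
apply: (@le_trans _ _ (\sum_x 2 ^- n * (`|f x| `^ (1 - t) * (f x ^+ 2) `^ t))).
  rewrite /pmean mulr_sumr; apply: ler_sum => x _; rewrite normcR.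
  rewrite ler_wpM2l// -[f x ^+ 2]real_normK ?num_real//.
  have [->|fn] := eqVneq `|f x| 0; first by rewrite powR0 ?mulr_ge0 ?powR_ge0// gt_eqF// addr_gt0.
  rewrite -powR_mulrn// -powRrM -powRD; last by rewrite fn implybT.
  rewrite le_eqVlt.
  by apply/orP; left; apply/eqP; congr (_ `^ _); ring.
have H := @hoelder_sum R _ (fun=> 2 ^- n) (fun=> wn)
  (fun x : cube n => `|f x| `^ (1 - t)) (fun x => (f x ^+ 2) `^ t)
  ((2 ^- n * \sum_x `|f x|) `^ (1 - t)) ((2 ^- n * \sum_x f x ^+ 2) `^ t)
  (1 - t)^-1 t^-1.
apply: H; rewrite ?invr_gt0 ?powR_gt0 ?invrK ?subrK//.
- by move=> x; rewrite powR_ge0.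
- rewrite -powRrM mulfV ?gt_eqF// powRr1 ?(ltW A0) ?(ltW B0)// mulr_sumr.
  by apply: ler_sum => x _; rewrite -powRrM mulfV ?gt_eqF// powRr1.
- rewrite -powRrM mulfV ?gt_eqF// powRr1 ?(ltW A0) ?(ltW B0)// mulr_sumr.
  by apply: ler_sum => x _; rewrite -powRrM mulfV ?gt_eqF// powRr1 ?sqr_ge0.
Qed.

(* The derivative of the difference is a positive multiple of (6 t - 1)^2; this
   double root is what links the constants 7/8 and 12/5. *)
Lemma ln_weight_ge t : 0 <= t -> 7 * (t / (1 + t)) <= 3 * ln (1 + 12 / 5 * t).
Proof.
move=> t0.
pose f (s : R) := 3 * ln (1 + 12 / 5 * s) - 7 * (s * (1 + s)^-1).
pose df (s : R) := 3 * ((1 + 12 / 5 * s)^-1 * (12 / 5)) - 7 * ((1 + s)^-1 - s * (1 + s) ^- 2).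
have fD (s : R) : - 1 / 3 < s -> is_derive s 1 f (df s).
  move=> s0.
  have p1 : 0 < 1 + 12 / 5 * s by lra.
  have p2 : 1 + s != 0 by rewrite gt_eqF//; lra.
  have g1 : is_derive s 1 (fun z : R => 1 + 12 / 5 * z) (12 / 5).
    by apply: is_derive_eq; rewrite /GRing.scale /= add0r; ring.
  have d1 := @is_derive1_comp _ (@ln R) (fun z : R => 1 + 12 / 5 * z) s _ _ (is_derive1_ln p1) g1.
  have d2 : is_derive s 1 (fun z : R => 1 + z) 1.
    by apply: is_derive_eq; rewrite add0r mulr1.
  have d3 : is_derive s 1 (fun z : R => (1 + z)^-1) (- (1 + s) ^- 2).
    split; first by apply: derivableV => //; case: d2.
    rewrite (deriveV p2); last by case: d2.
    by rewrite (@derive_val _ _ _ _ _ _ _ d2) /GRing.scale /= mulr1.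
  rewrite /f /df; apply: is_derive_eq.
  by rewrite /GRing.scale /=; ring.
have [->|tn] := eqVneq t 0; first by rewrite mul0r !mulr0 addr0 ln1 mulr0.
have fc : {within `[0, t], continuous f}.
  apply: derivable_within_continuous => y; rewrite in_itv /= => /andP[y0 yx].
  by have [] : is_derive y 1 f (df y) by apply: fD; lra.
have fD' (y : R) : y \in `]0, t[ -> is_derive y 1 f (df y).
  by rewrite in_itv /= => /andP[? ?]; apply: fD; lra.
have [c] := MVT_segment t0 fD' fc.
rewrite in_itv /= => /andP[c0 ct] E.
have F0 : f 0 = 0 by rewrite /f mul0r !mulr0 addr0 ln1 mulr0 subr0.
suff : 0 <= f t - f 0 by rewrite F0 subr0 /f subr_ge0.
rewrite E mulr_ge0// ?subr0//.
have c1 : 1 + c != 0 by rewrite gt_eqF//; lra.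
have c2 : 0 < 5 + 12 * c by lra.
have -> : df c = (6 * c - 1) ^+ 2 / ((5 + 12 * c) * (1 + c) ^+ 2).
  rewrite /df; field; rewrite c1 /= gt_eqF//.
by rewrite divr_ge0 ?sqr_ge0// mulr_ge0 ?sqr_ge0// ltW.
Qed.
End Energy.

(** * The maximum principle for complex polynomials *)

(** X^N - 1 splits and is separable, so it has N distinct roots, and they form a cyclic group. *)
Lemma closed_field_prim_root (F : closedFieldType) N :
  (0 < N)%N -> N%:R != 0 :> F -> exists z : F, N.-primitive_root z.
Proof.
move=> N0 NF.
have [r rE] := closed_field_poly_normal ('X^N - 1 : {poly F}).
move: rE; rewrite (monicP (monicXnsubC _ N0)) scale1r => rE.
have /hasP[z _ zP] : has N.-primitive_root r; last by exists z.
apply: has_prim_root => //.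
- by apply/allP => z; rewrite -root_prod_XsubC -rE.
- by rewrite -separable_prod_XsubC -rE separable_Xn_sub_1.
- by rewrite -ltnS -(size_prod_XsubC r id) -rE size_XnsubC.
Qed.

Section MaxPrinciple.
Import ComplexField.Normc.
Local Open Scope complex_scope.
Variable R : realType.
Local Notation C := R[i].

Lemma normcX (z : C) k : normc (z ^+ k) = normc z ^+ k.
Proof. by elim: k => [|k IH]; rewrite ?expr0 ?normc1 // !exprS normcM IH. Qed.

(** Cauchy's estimate, with the contour integral replaced by an average over the N-th roots of
    unity, which extracts a coefficient exactly once N exceeds the degree and the index. *)
Lemma coef_le_circle (p : {poly C}) (M : R) j :
  (forall z, normc z = 1 -> normc p.[z] <= M) -> normc p`_j <= M.
Proof.
move=> H; set N := (size p + j).+1.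
have N0 : (0 < N)%N by [].
have [w wP] : exists w : C, N.-primitive_root w by apply: closed_field_prim_root => //; rewrite pnatr_eq0.
have w1 : normc w = 1.
  apply/eqP; rewrite -(@pexpr_eq1 _ _ N) ?normc_ge0// -normcX prim_expr_order//.
  by rewrite normc1.
have wn0 : w != 0 by apply/eqP => w0; move: w1; rewrite w0 normc0 => /eqP; rewrite eq_sym oner_eq0.
have E : N%:R * p`_j = \sum_(k < N) p.[w ^+ k] * (w ^- j) ^+ k.
  under [RHS]eq_bigr => k _.
    rewrite (@horner_coef_wide _ N); last by rewrite /N ltnW// ltnS leq_addr.
    rewrite mulr_suml; under eq_bigr => i _ do
      rewrite -exprM mulnC exprM -mulrA -exprMn.
    over.
  rewrite exchange_big /=.
  have jN : (j < N)%N by rewrite /N ltnS leq_addl.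
  rewrite (bigD1 (Ordinal jN)) //= [X in _ = _ + X]big1 ?addr0.
    rewrite -mulr_sumr mulfV ?expf_neq0// (eq_bigr (fun=> 1)).
      by rewrite sumr_const card_ord mulrC.
    by move=> i _; rewrite expr1n.
  move=> i ij; rewrite -mulr_sumr.
  set u := w ^+ i / w ^+ j.
  have uN : u ^+ N = 1.
    by rewrite /u exprMn exprVn ![_ ^+ _ ^+ N]exprAC (prim_expr_order wP) !expr1n divr1.
  have u1 : u - 1 != 0.
    rewrite subr_eq0; apply: contra ij => /eqP u1; apply/eqP/val_inj => /=.
    have : w ^+ i == w ^+ j by rewrite -[w ^+ i](divfK (expf_neq0 j wn0)) -/u u1 mul1r.
    by rewrite (eq_prim_root_expr wP) !modn_small// => /eqP.
  suff -> : \sum_(k < N) u ^+ k = 0 by rewrite mulr0.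
  by apply: (mulfI u1); rewrite mulr0 -subrX1 uN subrr.
have : normc (N%:R * p`_j) <= N%:R * M.
  rewrite E; apply: le_trans (normc_sum _) _.
  have -> : N%:R * M = \sum_(k < N) M by rewrite sumr_const card_ord mulr_natl.
  apply: ler_sum => k _; rewrite normcM normcX.
  have -> : normc (w ^- j) = 1 by rewrite normcV normcX w1 expr1n invr1.
  by rewrite expr1n mulr1 H// normcX w1 expr1n.
by rewrite normcM -(rmorph_nat (real_complex R)) normcR ger0_norm// ler_pM2l// ltr0n.
Qed.

(** If a > b, Bernoulli's inequality makes (a / b)^k exceed any constant K. *)
Lemma exp_bound_le (a b K : R) : 0 <= a -> 0 <= b ->
  (forall k, a ^+ k <= K * b ^+ k) -> a <= b.
Proof.
move=> a0 b0 H; rewrite leNgt; apply/negP => ba.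
have [b00|bn] := eqVneq b 0.
  by have := H 1%N; rewrite b00 expr1 mulr0 leNgt -b00 ba.
have bp : 0 < b by rewrite lt_neqAle eq_sym bn.
pose x := a / b - 1.
have x0 : 0 < x by rewrite subr_gt0 ltr_pdivlMr ?mul1r.
have Hx k : (1 + x) ^+ k <= K.
  by rewrite /x subrKC expr_div_n ler_pdivrMr ?exprn_gt0.
have bern k : k%:R * x <= (1 + x) ^+ k.
  have : 1 + k%:R * x <= (1 + x) ^+ k; last by apply: le_trans; rewrite lerDr.
  elim: k => [|k IH]; first by rewrite mul0r addr0 expr0.
  rewrite exprS -natr1; have X1 : 0 <= 1 + x by lra.
  apply: le_trans (ler_wpM2l X1 IH).
  have : 0 <= k%:R * x * x by rewrite !mulr_ge0 // ltW.
  by lra.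
have := le_trans (bern (Num.bound (`|K| / x))) (Hx _).
apply/negP; rewrite -ltNge; apply: le_lt_trans (ler_norm K) _.
by rewrite -ltr_pdivrMr// archi_boundP// divr_ge0// ltW.
Qed.

(** The coefficients of p^k are at most M^k, so a geometric series gives |p(z0)|^k <= M^k / (1 -
    |z0|); the constant disappears as k grows. *)
Lemma max_principle (p : {poly C}) (M : R) z0 : 0 <= M ->
  (forall z, normc z = 1 -> normc p.[z] <= M) ->
  normc z0 < 1 -> normc p.[z0] <= M.
Proof.
move=> M0 H z1; have z00 := normc_ge0 z0.
apply: (@exp_bound_le _ _ (1 - normc z0)^-1) => //; first exact: normc_ge0.
move=> k; rewrite -normcX -horner_exp.
have Hk z : normc z = 1 -> normc (p ^+ k).[z] <= M ^+ k.
  by move=> /H Hz; rewrite horner_exp normcX lerXn2r// nnegrE ?normc_ge0.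
rewrite horner_coef; apply: le_trans (normc_sum _) _.
apply: (@le_trans _ _ (\sum_(i < size (p ^+ k)) M ^+ k * normc z0 ^+ i)).
  apply: ler_sum => i _; rewrite normcM normcX ler_wpM2r ?exprn_ge0//.
  exact: coef_le_circle.
rewrite -mulr_sumr mulrC ler_wpM2r ?exprn_ge0//.
rewrite -[leRHS]mul1r ler_pdivlMr ?subr_gt0// mulrC.
by rewrite -opprB mulNr -subrX1 opprB gerBl exprn_ge0.
Qed.

End MaxPrinciple.

(** * Upper bound *)

Section Upper.
Import ComplexField.Normc.
Local Open Scope complex_scope.
Variable R : realType.
Local Notation C := R[i].
Implicit Types (y t : R).

Lemma pnorm1E n (f : cube n -> R) : pnorm 1 f = 2 ^- n * \sum_x `|f x|.
Proof.
have w0 : 0 <= 2 ^- n :> R by rewrite invr_ge0 exprn_ge0.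
rewrite /pnorm invr1 (eq_bigr (fun x => `|f x|)) => [|x _]; rewrite powRr1//.
by rewrite mulr_ge0// sumr_ge0.
Qed.

Lemma pnorm2E n (f : cube n -> R) : pnorm 2 f = Num.sqrt (2 ^- n * \sum_x f x ^+ 2).
Proof.
have w0 : 0 <= 2 ^- n :> R by rewrite invr_ge0 exprn_ge0.
rewrite /pnorm (eq_bigr (fun x => f x ^+ 2)) => [|x _].
  by rewrite powR12_sqrt// mulr_ge0// sumr_ge0// => x _; rewrite sqr_ge0.
by rewrite powR_mulrn// real_normK ?num_real.
Qed.

Lemma parseval n (f : cube n -> R) :
  \sum_(S : {set 'I_n}) fourier f S ^+ 2 = 2 ^- n * \sum_x f x ^+ 2.
Proof.
under [in RHS]eq_bigr => x _ do rewrite expr2 {2}walsh_expansion mulr_sumr.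
rewrite exchange_big mulr_sumr /=; apply: eq_bigr => S _.
rewrite expr2 {1}/fourier -mulrA; congr (_ * _).
by rewrite mulr_suml; apply: eq_bigr => x _; rewrite /walsh mulrAC mulrA.
Qed.

Lemma mean_abs_gt0 n (f : cube n -> R) :
  0 < 2 ^- n * \sum_x f x ^+ 2 -> 0 < 2 ^- n * \sum_x `|f x|.
Proof.
move=> B0; rewrite lt_neqAle mulr_ge0 ?invr_ge0 ?exprn_ge0 ?sumr_ge0// andbT eq_sym.
rewrite mulf_neq0 ?invr_neq0 ?expf_neq0 ?pnatr_eq0//.
apply: contraTneq B0 => /eqP; rewrite psumr_eq0// => /allP H.
rewrite big1 ?mulr0 ?ltxx// => x _.
by have /eqP/normr0_eq0-> := H x (mem_index_enum x); rewrite expr0n.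
Qed.

Lemma pmean_gt0 n p (f : cube n -> R) :
  0 < 2 ^- n * \sum_x f x ^+ 2 -> 0 < pmean p (fun x => (f x)%:C).
Proof.
move=> B0; rewrite lt_neqAle pmean_ge0 andbT eq_sym.
rewrite mulf_neq0 ?invr_neq0 ?expf_neq0 ?pnatr_eq0//.
apply: contraTneq B0 => /eqP; rewrite psumr_eq0; last by move=> x _; rewrite powR_ge0.
move=> /allP H; rewrite big1 ?mulr0 ?ltxx// => x _.
have := H x (mem_index_enum x); rewrite normcR powR_eq0 normr_eq0 => /andP[/eqP-> _].
by rewrite expr0n.
Qed.

Lemma wenergy_conj n (f : cube n -> R) y :
  normc (wenergy f (0 +i* (- y))) = normc (wenergy f (0 +i* y)).
Proof.
have -> : wenergy f (0 +i* (- y)) = (wenergy f (0 +i* y))^*.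
  rewrite /wenergy rmorph_sum; apply: eq_bigr => S _.
  rewrite [RHS](rmorphM (@conjc R)) [X in _ = X * _](rmorphXn (@conjc R)); congr (_ * _).
  by rewrite /= oppr0.
by case: (wenergy _ _) => a b /=; rewrite sqrrN.
Qed.

Lemma wenergy0 n (f : cube n -> R) : wenergy f 0 = (fourier f finset.set0 ^+ 2)%:C.
Proof.
rewrite /wenergy (bigD1 finset.set0) //= cards0 expr0 mul1r big1 ?addr0// => S S0.
by rewrite expr0n cards_eq0 (negPf S0) mul0r.
Qed.

Lemma fourier0_le n (f : cube n -> R) :
  `|fourier f finset.set0| <= 2 ^- n * \sum_x `|f x|.
Proof.
rewrite /fourier normrM ger0_norm ?invr_ge0 ?exprn_ge0// ler_wpM2l ?invr_ge0 ?exprn_ge0//.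
apply: le_trans (ler_norm_sum _ _ _) _; apply: ler_sum => x _.
by rewrite /walsh big_set0 mulr1.
Qed.

Lemma powR_expR (a r : R) : 0 < a -> a `^ r = expR (r * ln a).
Proof. by move=> a0; rewrite /powR gt_eqF. Qed.

(** The hypothesis relating A and B negates [mean_sqr_lt]. In logarithms with t = y^2, ln |P(iy)| <=
    ln B - (7/4) d (1 - t) / (1 + t), and (1 - t) / (1 + t) = 1 - 2 t / (1 + t) brings in
    [ln_weight_ge]. Squaring turns the resulting exponent 3/2 into 3. *)
Lemma wenergy_weight n d (f : cube n -> R) y :
  let A := 2 ^- n * \sum_x `|f x| in
  let B := 2 ^- n * \sum_x f x ^+ 2 in
  0 < B -> A ^+ 2 <= B * expR (- (7 / 4)) ^+ d -> -1 < y < 1 ->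
  normc (wenergy f (0 +i* y)) ^+ 2 <=
  B ^+ 2 * (expR (- (7 / 2)) * (1 + 12 / 5 * y ^+ 2) ^+ 3) ^+ d.
Proof.
move=> A B B0 AB.
have A0 : 0 < A := mean_abs_gt0 B0.
wlog y0 : y / 0 <= y.
  move=> H /andP[y1 y2]; case: (lerP 0 y) => y0; first by apply: H; rewrite ?y1.
  rewrite -[y]opprK wenergy_conj sqrrN; apply: H; first lra.
  by apply/andP; split; lra.
move=> /andP[_ y1].
have E2 : expR (- (7 / 2)) = expR (- (7 / 4)) ^+ 2 :> R.
  by rewrite -expRM_natl; congr expR; field.
(* The noise bound is available for y > 0 only; at y = 0, P(0) is the square of the mean, at most
   A^2. *)
have [->|yn] := eqVneq y 0.
  rewrite -[0 +i* 0]/(0 : C) wenergy0 normcR expr0n mulr0 addr0 expr1n mulr1.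
  rewrite ger0_norm ?sqr_ge0// E2 -[X in _ <= _ * X]exprM mulnC exprM -exprMn.
  have BE : 0 <= B * expR (- (7 / 4)) ^+ d.
    by rewrite mulr_ge0 ?exprn_ge0 ?expR_ge0// ltW.
  have FE : fourier f finset.set0 ^+ 2 <= B * expR (- (7 / 4)) ^+ d.
    apply: le_trans AB; rewrite -[fourier _ _ ^+ 2]real_normK ?num_real//.
    by apply: lerXn2r; rewrite ?nnegrE ?(ltW A0)// fourier0_le.
  by apply: lerXn2r; rewrite ?nnegrE ?sqr_ge0.
have yp : 0 < y by rewrite lt_neqAle eq_sym yn.
have m0 := pmean_gt0 (1 + y ^+ 2) B0.
have t0 : 0 < y ^+ 2 by rewrite exprn_gt0.
have t1 : y ^+ 2 < 1 by rewrite expr_lt1.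
have H1 := wenergy_le_pmean yp (ltW y1) m0.
have H2 := pmean_log_convex t0 t1 A0 B0.
have H3 := ln_weight_ge (ltW t0).
rewrite -/A -/B in H2.
move: (y ^+ 2) t0 t1 m0 H1 H2 H3 => t t0 t1 m0 H1 H2 H3.
set m := pmean _ _ in H1 H2 m0.
have tp : 0 < 1 + t by rewrite addr_gt0.
have lA : 2 * ln A <= ln B - 7 / 4 * d%:R.
  rewrite (_ : 2 * ln A = ln (A ^+ 2)); last by rewrite lnXn// mulr_natl.
  apply: (@le_trans _ _ (ln (B * expR (- (7 / 4)) ^+ d))).
    by rewrite ler_ln ?posrE ?exprn_gt0// mulr_gt0// exprn_gt0// expR_gt0.
  rewrite lnM ?posrE ?exprn_gt0 ?expR_gt0// lnXn ?expR_gt0// expRK.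
  by rewrite mulNrn mulr_natr.
have lm : ln m <= (1 - t) * ln A + t * ln B.
  apply: (@le_trans _ _ (ln (A `^ (1 - t) * B `^ t))).
    by rewrite ler_ln // posrE ?mulr_gt0 ?powR_gt0.
  by rewrite lnM ?posrE ?powR_gt0// !ln_powR.
have s1 : 0 <= 1 - t by rewrite subr_ge0 ltW.
have lm2 : 2 * ln m <= (1 + t) * ln B - 7 / 4 * d%:R * (1 - t).
  have := ler_wpM2l s1 lA; lra.
have lmf : 2 / (1 + t) * ln m <= ln B - 7 / 4 * d%:R + 7 / 2 * d%:R * (t / (1 + t)).
  rewrite mulrAC ler_pdivrMr//; apply: le_trans lm2 _.
  by rewrite le_eqVlt; apply/orP; left; apply/eqP; field; rewrite gt_eqF.
have pos : 0 < 1 + 12 / 5 * t by lra.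
have -> : B ^+ 2 * (expR (- (7 / 2)) * (1 + 12 / 5 * t) ^+ 3) ^+ d =
   expR (2%:R * (ln B + d%:R * (- (7 / 4) + 3 / 2 * ln (1 + 12 / 5 * t)))).
  rewrite expRM_natl expRD lnK ?posrE// expRM_natl [RHS]exprMn; congr (_ * _).
  rewrite [RHS]exprAC; congr (_ ^+ _).
  rewrite E2 expRD exprMn; congr (_ * _).
  rewrite -expRM_natl (_ : 2%:R * _ = 3%:R * ln (1 + 12 / 5 * t)); last by field.
  by rewrite expRM_natl lnK.
rewrite expRM_natl lerXn2r ?nnegrE ?normc_ge0 ?expR_ge0//.
apply: le_trans H1 _; rewrite powR_expR// ler_expR; apply: le_trans lmf _.
have d0 : 0 <= d%:R :> R by [].
have := ler_wpM2l d0 H3; lra.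
Qed.

End Upper.

(** * Transfer to the unit circle and numerical estimates *)

Section Assembly.
Import ComplexField.Normc.
Local Open Scope complex_scope.
Variable R : realType.
Local Notation C := R[i].

(** This is z^d P((3/8) (z - 1/z)) with denominators cleared. Where |S| > d the truncated exponent
    is wrong, but for degree at most d those coefficients vanish. *)
Definition energy_poly n d (f : cube n -> R) : {poly C} :=
  \sum_(S : {set 'I_n}) (fourier f S ^+ 2 * (3 / 8) ^+ #|S|)%:C *:
    (('X^2 - 1) ^+ #|S| * 'X^(d - #|S|)).

Lemma fourier_degree n d (f : cube n -> R) (S : {set 'I_n}) :
  (degree f <= d)%N -> (d < #|S|)%N -> fourier f S = 0.
Proof.
move=> fd dS; apply/eqP; apply: contraTT dS => fS; rewrite -leqNgt.
by apply: leq_trans fd; exact: (@leq_bigmax_cond _ (fun S => fourier f S != 0) (fun S => #|S|) S fS).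
Qed.

Lemma horner_energy_poly n d (f : cube n -> R) (z : C) :
  (degree f <= d)%N -> z != 0 ->
  (energy_poly d f).[z] = z ^+ d * wenergy f ((3 / 8)%:C * (z - z^-1)).
Proof.
move=> fd z0; rewrite /energy_poly /wenergy horner_sum mulr_sumr.
apply: eq_bigr => S _; rewrite hornerZ hornerM !(horner_exp, hornerD, hornerN, hornerX, hornerC).
case: (leqP #|S| d) => Sd; last first.
  by rewrite (fourier_degree fd Sd) expr0n mul0r !(mul0r, mulr0).
have -> : (fourier f S ^+ 2 * (3 / 8) ^+ #|S|)%:C
    = (fourier f S ^+ 2)%:C * (3 / 8)%:C ^+ #|S| :> C by rewrite -rmorphXn -rmorphM.
have -> : z ^+ 2 - 1 = z * (z - z^-1) by rewrite mulrBr mulfV.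
rewrite -{2}(subnK Sd) exprD !exprMn.
move: (fourier f S ^+ 2)%:C ((3 / 8)%:C) (z - z^-1) => a c v; ring.
Qed.

(* (19^4 - (4 z^2)^4) / (19 - 4 z^2): a truncated geometric series, hence a
   polynomial approximation of 19^4 / (19 - 4 z^2) on the unit disc. *)
Definition damping_poly : {poly C} :=
  (19 ^+ 3)%:P + (19 ^+ 2 * 4)%:P * 'X^2 + (19 * 4 ^+ 2)%:P * 'X^4 + (4 ^+ 3)%:P * 'X^6.

Lemma horner_damping_poly (z : C) :
  damping_poly.[z] =
  19 ^+ 3 + 19 ^+ 2 * 4 * z ^+ 2 + 19 * 4 ^+ 2 * z ^+ 4 + 4 ^+ 3 * z ^+ 6.
Proof.
by rewrite /damping_poly !(hornerD, hornerM, horner_exp, hornerX, hornerC).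
Qed.

Lemma normc_nat k : normc (k%:R : C) = k%:R.
Proof. by rewrite -(rmorph_nat (real_complex R)) normcR ger0_norm. Qed.

(** The product telescopes to 19^4 - 4^4 z^8, to which the triangle inequality applies. *)
Lemma damping_poly_bound (z : C) : normc z = 1 ->
  normc damping_poly.[z] * normc (19 - 4 * z ^+ 2) <= 19 ^+ 4 + 4 ^+ 4.
Proof.
move=> z1; rewrite -normcM horner_damping_poly.
have -> : (19 ^+ 3 + 19 ^+ 2 * 4 * z ^+ 2 + 19 * 4 ^+ 2 * z ^+ 4 + 4 ^+ 3 * z ^+ 6)
   * (19 - 4 * z ^+ 2) = 19 ^+ 4 - 4 ^+ 4 * z ^+ 8 :> C by ring.
apply: le_trans (le_normcD _ _) _.
have nN (u : C) : normc (- u) = normc u by case: u => a b /=; rewrite !sqrrN.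
have -> : normc (- (4 ^+ 4 * z ^+ 8)) = 4 ^+ 4.
  by rewrite nN normcM !normcX z1 expr1n mulr1 normc_nat.
by rewrite -[normc _]/(normc (19 ^+ 4)) normcX normc_nat.
Qed.

(** With b = Im z, the right side equals 1 + (304/225) b^2, where 225 = (19 - 4)^2; on the left the
    coefficient is (12/5) (9/16) = 27/20, slightly smaller. *)
Lemma circle_weight (z : C) : normc z = 1 ->
  1 + 12 / 5 * (3 / 4 * complex.Im z) ^+ 2 <= normc (19 - 4 * z ^+ 2) ^+ 2 / 225.
Proof.
case: z => a b z1.
have ab : a ^+ 2 + b ^+ 2 = 1 by rewrite -(normc_sq (a +i* b)) z1 expr1n.
rewrite normc_sq -!(rmorph_nat (real_complex R)) /=.
have -> : (19 - (4 * (a * a - b * b) - 0 * (a * b + b * a))) ^+ 2 +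
  (0 - (4 * (a * b + b * a) + 0 * (a * a - b * b))) ^+ 2
  = 361 + 16 * (a ^+ 2 + b ^+ 2) ^+ 2 - 152 * ((a ^+ 2 + b ^+ 2) - 2 * b ^+ 2) :> R by ring.
rewrite ab; have := sqr_ge0 b; rewrite exprMn; lra.
Qed.

(** On the unit circle 1/z is the conjugate of z, so z - 1/z = 2 i Im z. *)
Lemma circle_arg (z : C) : normc z = 1 ->
  (3 / 8)%:C * (z - z^-1) = 0 +i* (3 / 4 * complex.Im z).
Proof.
case: z => a b z1.
have ab : a ^+ 2 + b ^+ 2 = 1 by rewrite -(normc_sq (a +i* b)) z1 expr1n.
have -> : (a +i* b)^-1 = a -i* b :> C.
  have z0 : a +i* b != 0 :> C.
    by apply/eqP => z0; move: z1; rewrite z0 normc0 => /eqP; rewrite eq_sym oner_eq0.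
  apply: (mulfI z0); rewrite mulfV//; apply/eqP; rewrite eq_complex /=.
  by rewrite !mulrN opprK -!expr2 ab (mulrC b) addNr !eqxx.
apply/eqP; rewrite eq_complex /= subrr opprK !(mul0r, mulr0, subr0, addr0).
by rewrite eqxx /=; apply/eqP; field.
Qed.

(** One squaring step for numerical bounds: from a lower bound a on e^k, any b rounded down from a^2
    serves for e^(2k). *)
Lemma expR_double_ge (k a b : R) : 0 <= a -> a <= expR k -> b <= a ^+ 2 ->
  b <= expR (2 * k).
Proof.
move=> a0 ak ba; apply: le_trans ba _.
by rewrite expRM_natl; apply: lerXn2r; rewrite ?nnegrE// expR_ge0.
Qed.

(** Eight doublings from 1 + x <= e^x at x = 7/1024, with decimals rounded down each time. *)
Lemma expR_7_4 : 1143 / 200 < expR (7 / 4) :> R.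
Proof.
have h : 1 + 7 / 1024 <= expR (7 / 1024) :> R by apply: expR_ge1Dx.
rewrite -[X in expR X]mul1r -(expr0 2) in h.
have {}h : 1 + 13 / 1000 + 718 / (1000 * 1000) <= expR (2 ^+ 1 * (7 / 1024)) :> R.
  by rewrite exprS -mulrA; apply: (expR_double_ge _ h); lra.
have {}h : 1 + 27 / 1000 + 624 / (1000 * 1000) <= expR (2 ^+ 2 * (7 / 1024)) :> R.
  by rewrite exprS -mulrA; apply: (expR_double_ge _ h); lra.
have {}h : 1 + 56 / 1000 + 11 / (1000 * 1000) <= expR (2 ^+ 3 * (7 / 1024)) :> R.
  by rewrite exprS -mulrA; apply: (expR_double_ge _ h); lra.
have {}h : 1 + 115 / 1000 + 159 / (1000 * 1000) <= expR (2 ^+ 4 * (7 / 1024)) :> R.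
  by rewrite exprS -mulrA; apply: (expR_double_ge _ h); lra.
have {}h : 1 + 243 / 1000 + 579 / (1000 * 1000) <= expR (2 ^+ 5 * (7 / 1024)) :> R.
  by rewrite exprS -mulrA; apply: (expR_double_ge _ h); lra.
have {}h : 1 + 546 / 1000 + 488 / (1000 * 1000) <= expR (2 ^+ 6 * (7 / 1024)) :> R.
  by rewrite exprS -mulrA; apply: (expR_double_ge _ h); lra.
have {}h : 2 + 391 / 1000 + 625 / (1000 * 1000) <= expR (2 ^+ 7 * (7 / 1024)) :> R.
  by rewrite exprS -mulrA; apply: (expR_double_ge _ h); lra.
have {}h : 5 + 719 / 1000 + 870 / (1000 * 1000) <= expR (2 ^+ 8 * (7 / 1024)) :> R.
  by rewrite exprS -mulrA; apply: (expR_double_ge _ h); lra.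
rewrite (_ : 7 / 4 = 2 ^+ 8 * (7 / 1024)); last by field.
by apply: lt_le_trans h; lra.
Qed.

(** Squaring yields lower bounds only, so e^(-7/8) is bounded below and inverted: 2.409 times
    0.415571 exceeds 1. *)
Lemma expR_7_8 : expR (7 / 8) < 2409 / 1000 :> R.
Proof.
have h : 1 + - (7 / 1024) <= expR (- (7 / 1024)) :> R by apply: expR_ge1Dx.
rewrite -[X in expR X]mul1r -(expr0 2) in h.
have {}h : 0 + 986 / 1000 + 374 / (1000 * 1000) <= expR (2 ^+ 1 * - (7 / 1024)) :> R.
  by rewrite exprS -mulrA; apply: (expR_double_ge _ h); lra.
have {}h : 0 + 972 / 1000 + 933 / (1000 * 1000) <= expR (2 ^+ 2 * - (7 / 1024)) :> R.
  by rewrite exprS -mulrA; apply: (expR_double_ge _ h); lra.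
have {}h : 0 + 946 / 1000 + 598 / (1000 * 1000) <= expR (2 ^+ 3 * - (7 / 1024)) :> R.
  by rewrite exprS -mulrA; apply: (expR_double_ge _ h); lra.
have {}h : 0 + 896 / 1000 + 47 / (1000 * 1000) <= expR (2 ^+ 4 * - (7 / 1024)) :> R.
  by rewrite exprS -mulrA; apply: (expR_double_ge _ h); lra.
have {}h : 0 + 802 / 1000 + 900 / (1000 * 1000) <= expR (2 ^+ 5 * - (7 / 1024)) :> R.
  by rewrite exprS -mulrA; apply: (expR_double_ge _ h); lra.
have {}h : 0 + 644 / 1000 + 648 / (1000 * 1000) <= expR (2 ^+ 6 * - (7 / 1024)) :> R.
  by rewrite exprS -mulrA; apply: (expR_double_ge _ h); lra.
have {}h : 0 + 415 / 1000 + 571 / (1000 * 1000) <= expR (2 ^+ 7 * - (7 / 1024)) :> R.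
  by rewrite exprS -mulrA; apply: (expR_double_ge _ h); lra.
rewrite (_ : 2 ^+ 7 * - (7 / 1024) = - (7 / 8)) in h; last by field.
rewrite ltNge; apply/negP => h2.
have h3 : 2409 / 1000 * (415 / 1000 + 571 / (1000 * 1000)) <= 1 :> R.
  by rewrite -[leRHS](expRxMexpNx_1 (7 / 8)); apply: ler_pM; lra.
lra.
Qed.

(** If the bound fails, Q is at most B M^d on the unit circle, but its value at -1/3 has modulus B
    (v^3 / 3)^d, and M < v^3 / 3. *)
Lemma mean_sqr_lt n d (f : cube n -> R) :
  (0 < d)%N -> (degree f <= d)%N ->
  let A := 2 ^- n * \sum_x `|f x| in
  let B := 2 ^- n * \sum_x f x ^+ 2 in
  0 < B -> B * expR (- (7 / 4)) ^+ d < A ^+ 2.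
Proof.
move=> d0 fd A B B0; rewrite ltNge; apply/negP => AB.
pose e : R := expR (- (7 / 4)).
have e0 : 0 < e by rewrite expR_gt0.
(* Per unit of d, three damping factors, each at most (19^4 + 4^4) / |19 - 4 z^2|, cancel the |19 -
   4 z^2|^3 in the bound on P and leave 15^-3 and e. *)
pose M : R := ((19 ^+ 4 + 4 ^+ 4) / 15) ^+ 3 * e.
have M0 : 0 <= M by rewrite mulr_ge0 ?exprn_ge0// ltW.
pose Q := energy_poly d f * damping_poly ^+ (3 * d).
have HQ z : normc z = 1 -> normc Q.[z] <= B * M ^+ d.
  move=> z1; have zn0 : z != 0.
    by apply/eqP => z0; move: z1; rewrite z0 normc0 => /eqP; rewrite eq_sym oner_eq0.
  rewrite /Q hornerM (horner_energy_poly fd zn0) circle_arg// horner_exp !normcM !normcX z1 expr1n mul1r.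
  have Iz : -1 < 3 / 4 * complex.Im z < 1.
    have b1 : complex.Im z ^+ 2 <= 1.
      by rewrite -[leRHS](expr1n _ 2) -z1 normc_sq lerDr sqr_ge0.
    have : `|complex.Im z| <= 1.
      by rewrite -(@ler_pXn2r _ 2) ?nnegrE // real_normK ?num_real// expr1n.
    by rewrite ler_norml => /andP[? ?]; apply/andP; split; lra.
  have HW := wenergy_weight B0 AB Iz; rewrite -/A -/B in HW.
  have HN := circle_weight z1.
  have HV := damping_poly_bound z1.
  set W := normc (wenergy _ _) in HW *; set V := normc (damping_poly.[z]) in HV *.
  set N := normc (19 - _) in HN HV.
  have W0 : 0 <= W by rewrite normc_ge0.
  have V0 : 0 <= V by rewrite normc_ge0.
  have N0 : 0 <= N by rewrite normc_ge0.
  have L0 : 0 <= W * V ^+ (3 * d) by rewrite mulr_ge0 ?exprn_ge0.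
  have R0 : 0 <= B * M ^+ d by rewrite mulr_ge0 ?(ltW B0) ?exprn_ge0.
  apply: (sqr_le_le R0).
  have -> : (W * V ^+ (3 * d)) ^+ 2 = W ^+ 2 * (V ^+ 6) ^+ d.
    by rewrite exprMn -!exprM; congr (_ * _ ^+ _); rewrite mulnAC.
  have -> : (B * M ^+ d) ^+ 2 = B ^+ 2 * (M ^+ 2) ^+ d by rewrite exprMn exprAC.
  apply: le_trans (ler_wpM2r _ HW) _; first by rewrite !exprn_ge0.
  rewrite -[leLHS]mulrA -exprMn ler_wpM2l ?sqr_ge0//.
  have w0 : 0 <= 1 + 12 / 5 * (3 / 4 * complex.Im z) ^+ 2.
    by have := sqr_ge0 (3 / 4 * complex.Im z); lra.
  have -> : expR (- (7 / 2)) = e ^+ 2 :> R.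
    by rewrite /e -expRM_natl; congr expR; field.
  apply: exprn_le; first by rewrite !mulr_ge0 ?exprn_ge0 ?(ltW e0).
  have -> : M ^+ 2 = e ^+ 2 * (((19 ^+ 4 + 4 ^+ 4) ^+ 2 / 225) ^+ 3) by rewrite /M; field.
  rewrite -[leLHS]mulrA ler_wpM2l ?sqr_ge0//.
  have -> : V ^+ 6 = (V ^+ 2) ^+ 3 by rewrite -exprM.
  rewrite -exprMn.
  apply: exprn_le; first by rewrite mulr_ge0 ?exprn_ge0.
  apply: le_trans (ler_wpM2r _ HN) _; first by rewrite exprn_ge0.
  rewrite mulrAC ler_wpM2r// -exprMn mulrC.
  by apply: exprn_le; rewrite ?mulr_ge0.
(* At -1/3 the argument (3/8) (z - 1/z) is 1, where P equals B. *)
have z1 : normc (- (1 / 3))%:C < 1 :> R by rewrite normcR normrN ger0_norm; lra.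
have := max_principle _ HQ z1.
rewrite mulr_ge0 ?exprn_ge0 ?(ltW B0)// => /(_ isT).
rewrite /Q hornerM (horner_energy_poly fd); last first.
  by rewrite eq_complex /= eqxx andbT oppr_eq0; apply/eqP; lra.
have -> : (3 / 8)%:C * ((- (1 / 3))%:C - (- (1 / 3))%:C^-1) = 1 :> C.
  rewrite -fmorphV -rmorphB -rmorphM (_ : _ * _ = 1) ?rmorph1//; by field.
have -> : wenergy f 1 = B%:C.
  rewrite /B -parseval /wenergy rmorph_sum; apply: eq_bigr => S _.
  by rewrite expr1n mul1r.
rewrite horner_exp.
(* The value of the damping polynomial where z^2 = 1/9. *)
pose v : R := 19 ^+ 3 + 19 ^+ 2 * 4 / 9 + 19 * 4 ^+ 2 / 9 ^+ 2 + 4 ^+ 3 / 9 ^+ 3.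
have v0 : 0 <= v by rewrite /v; lra.
have -> : damping_poly.[(- (1 / 3))%:C] = v%:C.
  rewrite horner_damping_poly /v.
  rewrite !(rmorphD, rmorphN, rmorphM, rmorphXn, fmorphV, rmorph_nat, rmorph1) /=.
  by field.
rewrite !normcM !normcX !normcR normrN (ger0_norm v0) (ger0_norm (ltW B0)) ger0_norm; last lra.
rewrite mulrAC mulrC ler_pM2l// exprM -exprMn mulrC.
apply/negP; rewrite -ltNge.
have eb : e < 200 / 1143.
  rewrite ltNge; apply/negP => eb.
  have E0 : 0 <= expR (7 / 4) :> R by rewrite expR_ge0.
  have := ler_wpM2l E0 eb; rewrite /e expRxMexpNx_1.
  by have := expR_7_4; lra.
(* The factor 1/3 is |z|, from z^d. With 200/1143 in place of e the margin is below one part in a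
   thousand. *)
suff MV : M < v ^+ 3 * (1 / 3) by rewrite ltrXn2r// -lt0n.
apply: (@lt_trans _ _ (((19 ^+ 4 + 4 ^+ 4) / 15) ^+ 3 * (200 / 1143))).
  by rewrite /M ltr_pM2l// exprn_gt0// divr_gt0// addr_gt0// exprn_gt0.
rewrite /v; lra.
Qed.

Lemma pnorm2_le_pnorm1 n d (f : cube n -> R) :
  (0 < d)%N -> (degree f <= d)%N ->
  pnorm 2 f <= expR (7 / 8) ^+ d * pnorm 1 f.
Proof.
move=> d0 fd; rewrite pnorm1E pnorm2E.
have [f0 |fn] := eqVneq (2 ^- n * \sum_x f x ^+ 2) 0.
  rewrite f0 sqrtr0 mulr_ge0 ?exprn_ge0 ?expR_ge0//.
  by rewrite mulr_ge0 ?invr_ge0 ?exprn_ge0// sumr_ge0.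
have B0 : 0 < 2 ^- n * \sum_x f x ^+ 2.
  rewrite lt_neqAle eq_sym fn mulr_ge0 ?invr_ge0 ?exprn_ge0// sumr_ge0// => x _.
  exact: sqr_ge0.
have := mean_sqr_lt d0 fd B0; move: B0.
set A := 2 ^- n * \sum_x `|f x|; set B := 2 ^- n * _ => B0 BA.
have A0 : 0 <= A by rewrite mulr_ge0 ?invr_ge0 ?exprn_ge0// sumr_ge0.
have e1 : expR (- (7 / 4)) * expR (7 / 8) ^+ 2 = 1 :> R.
  by rewrite -expRM_natl -expRD -[RHS]expR0; congr expR; field.
apply: sqr_le_le; first by rewrite mulr_ge0// exprn_ge0// expR_ge0.
rewrite sqr_sqrtr ?(ltW B0)// exprMn.
have E0 : 0 <= (expR (7 / 8) ^+ d) ^+ 2 :> R by rewrite sqr_ge0.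
rewrite mulrC; apply: le_trans (ler_wpM2r E0 (ltW BA)).
by rewrite -mulrA (exprAC _ d 2%N) -exprMn e1 expr1n mulr1.
Qed.
End Assembly.

(** * Lower bound *)

Section Lower.
Variable R : realType.

Lemma walshM n (S T : {set 'I_n}) (x : cube n) :
  walsh R S x * walsh R T x = walsh R ((S :\: T) :|: (T :\: S)) x.
Proof.
rewrite walshM_big /walsh [RHS]big_mkcond /=; apply: eq_bigr => i _.
rewrite !inE; case: (i \in S); case: (i \in T); rewrite /= ?mulr1 ?mul1r //.
by rewrite /coord -expr2 sqrr_sign.
Qed.

Definition esym n k (x : cube n) : R := \sum_(S : {set 'I_n} | #|S| == k) walsh R S x.

(** Products of two Walsh functions of level k are Walsh functions of symmetric differences, which
    have at most 2 k elements. *)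
Lemma degree_esym_sqr n k : (degree (fun x : cube n => esym k x ^+ 2) <= k + k)%N.
Proof.
apply/bigmax_leqP => U; apply: contraNT; rewrite -ltnNge => kU.
rewrite /fourier; apply/eqP.
have E (x : cube n) : esym k x ^+ 2 * walsh R U x =
    \sum_(S : {set 'I_n} | #|S| == k) \sum_(T : {set 'I_n} | #|T| == k)
      walsh R ((S :\: T) :|: (T :\: S)) x * walsh R U x.
  rewrite expr2 /esym !mulr_suml; apply: eq_bigr => S _.
  rewrite mulr_sumr mulr_suml; apply: eq_bigr => T _.
  by rewrite walshM.
rewrite (eq_bigr _ (fun x _ => E x)) exchange_big /= big1 ?mulr0// => S /eqP Sk.
rewrite exchange_big /= big1// => T /eqP Tk.
rewrite sum_walsh_cube; case: eqP => // STU; move: kU; rewrite -STU ltnNge.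
move=> /negP; case; rewrite -{1}Sk -{1}Tk.
apply: leq_trans (leq_card_setU _ _) _.
by apply: leq_add; rewrite subset_leq_card// finset.subsetDl.
Qed.

Lemma fourier_esym n k (S : {set 'I_n}) : fourier (esym k) S = (#|S| == k)%:R.
Proof.
rewrite -(@walsh_unique R n (esym k) (fun S => (#|S| == k)%:R)) // => x.
rewrite /esym big_mkcond; apply: eq_bigr => T _.
by case: eqP; rewrite ?mul1r ?mul0r.
Qed.

Lemma sum_cube_prod n (phi : bool -> R) :
  \sum_(x : cube n) \prod_i phi (x i) = (phi true + phi false) ^+ n.
Proof.
rewrite -(bigA_distr_bigA (fun _ b => phi b)) big_bool /=.
by rewrite prodr_const card_ord.
Qed.

Definition riesz n (r : R) (x : cube n) : R := \prod_i (1 + r * coord R x i).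

Lemma mean_riesz n (r : R) m :
  2 ^- n * \sum_x @riesz n r x ^+ m = (((1 + r) ^+ m + (1 - r) ^+ m) / 2) ^+ n.
Proof.
under eq_bigr => x _ do rewrite /riesz -prodrXl.
rewrite (sum_cube_prod n (fun b : bool => (1 + r * (-1) ^+ b) ^+ m)).
by rewrite expr1 expr0 mulr1 mulrN1 expr_div_n mulrC addrC.
Qed.

Lemma riesz_esym n (r : R) (x : cube n) :
  riesz r x = \sum_(k < n.+1) r ^+ k * esym k x.
Proof.
rewrite /riesz (eq_bigr (fun i => r * coord R x i + 1)) => [|i _]; last by rewrite addrC.
rewrite bigA_distr (partition_big (fun S : {set 'I_n} => inord #|S| : 'I_n.+1) predT)//=.
apply: eq_bigr => k _; rewrite /esym mulr_sumr; apply: eq_big => [S|S /eqP Sk].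
  rewrite -val_eqE /= inordK// ltnS.
  by apply: leq_trans (max_card _) _; rewrite card_ord.
rewrite -big_mkcond big_split /= prodr_const /walsh; congr (_ ^+ _ * _).
rewrite -Sk inordK// ltnS; apply: leq_trans (max_card _) _; by rewrite card_ord.
Qed.

Lemma fourier_riesz n (r : R) (S : {set 'I_n}) : fourier (riesz r) S = r ^+ #|S|.
Proof.
rewrite -(@walsh_unique R n (riesz r) (fun S => r ^+ #|S|)) // => x.
rewrite /riesz (eq_bigr (fun i => r * coord R x i + 1)) => [|i _]; last by rewrite addrC.
rewrite bigA_distr; apply: eq_bigr => T _.
by rewrite -big_mkcond big_split /= prodr_const.
Qed.

(** By Parseval the left side is the level-k part, and the right side the whole, of the second
    moment of the Riesz product with parameter r. *)
Lemma mean_esym_le n k (r : R) :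
  r ^+ (2 * k) * (2 ^- n * \sum_x @esym n k x ^+ 2) <= (1 + r ^+ 2) ^+ n.
Proof.
have -> : (1 + r ^+ 2) ^+ n = 2 ^- n * \sum_x @riesz n r x ^+ 2.
  by rewrite mean_riesz; congr (_ ^+ _); field.
rewrite -!parseval mulr_sumr; apply: ler_sum => S _.
rewrite fourier_esym fourier_riesz; case: eqP => [->|_].
  by rewrite expr1n mulr1 -exprM mulnC.
by rewrite expr0n mulr0 sqr_ge0.
Qed.

Lemma sqr_sum_le m (a : 'I_m -> R) :
  (\sum_i a i) ^+ 2 <= m%:R * \sum_i a i ^+ 2.
Proof.
have -> : m%:R * \sum_i a i ^+ 2 = \sum_i \sum_j (a i ^+ 2 + a j ^+ 2) / 2.
  under [RHS]eq_bigr => i _ do rewrite -mulr_suml big_split /= sumr_const card_ord.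
  rewrite -mulr_suml big_split /= sumr_const card_ord sumrMnl mulr_natl.
  by field.
rewrite expr2 mulr_suml; apply: ler_sum => i _; rewrite mulr_sumr.
apply: ler_sum => j _; have := sqr_ge0 (a i - a j); rewrite sqrrB; lra.
Qed.

(** The quadratic case is used twice. With m = n + 1 levels the loss m^3 is only polynomial in n. *)
Lemma pow4_sum_le m (a : 'I_m -> R) :
  (\sum_i a i) ^+ 4 <= m%:R ^+ 3 * \sum_i a i ^+ 4.
Proof.
have E4 (z : R) : z ^+ 4 = (z ^+ 2) ^+ 2 by rewrite -exprM.
rewrite [leLHS]E4.
apply: (@le_trans _ _ ((m%:R * \sum_i a i ^+ 2) ^+ 2)).
  by apply: exprn_le; [exact: sqr_ge0 | exact: sqr_sum_le].
rewrite exprMn [m%:R ^+ 3]exprSr -mulrA ler_wpM2l ?exprn_ge0//.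
under [X in _ <= _ * X]eq_bigr => i _ do rewrite E4.
exact: sqr_sum_le.
Qed.

(** A polynomial factor cannot make up for a ratio a / b = 1 + x > 1. At the exponent 5 k, (k x)^5
    <= (1 + x)^(5 k) <= (5 k + 1)^4 <= (6 k)^4, so k x^5 <= 6^4 for every k > 0. *)
Lemma exp_poly_bound_le (a b : R) : 0 <= a -> 0 < b ->
  (forall n, (0 < n)%N -> a ^+ n <= n.+1%:R ^+ 4 * b ^+ n) -> a <= b.
Proof.
move=> a0 bp H; rewrite leNgt; apply/negP => ba.
pose x := a / b - 1.
have x0 : 0 < x by rewrite subr_gt0 ltr_pdivlMr ?mul1r.
have Hx k : (0 < k)%N -> (1 + x) ^+ k <= k.+1%:R ^+ 4.
  by move=> k0; rewrite /x subrKC expr_div_n ler_pdivrMr ?exprn_gt0// H.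
have bern k : k%:R * x <= (1 + x) ^+ k.
  have : 1 + k%:R * x <= (1 + x) ^+ k; last by apply: le_trans; rewrite lerDr.
  elim: k => [|k IH]; first by rewrite mul0r addr0 expr0.
  rewrite exprS -natr1; have X1 : 0 <= 1 + x by lra.
  apply: le_trans (ler_wpM2l X1 IH).
  have : 0 <= k%:R * x * x by rewrite !mulr_ge0 // ltW.
  by lra.
have bd k : (0 < k)%N -> k%:R * x ^+ 5 <= 6 ^+ 4.
  move=> k0; have k0' : 0 < k%:R :> R by rewrite ltr0n.
  have h1 : (k%:R * x) ^+ 5 <= (1 + x) ^+ (k * 5).
    by rewrite exprM; apply: exprn_le; rewrite ?mulr_ge0// ltW.
  have h2 : (k * 5).+1%:R ^+ 4 <= (6 * k%:R) ^+ 4 :> R.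
    by apply: exprn_le => //; rewrite -natrM ler_nat; case: (k) k0 => // k' _; rewrite !mulnS; lia.
  have := le_trans h1 (le_trans (Hx _ _) h2); rewrite muln_gt0 k0 => /(_ isT).
  rewrite !exprMn exprS -mulrA [X in _ <= X]mulrC.
  have -> : k%:R * (k%:R ^+ 4 * x ^+ 5) = k%:R ^+ 4 * (k%:R * x ^+ 5) by ring.
  by rewrite ler_pM2l// exprn_gt0.
have x5 : 0 < x ^+ 5 by rewrite exprn_gt0.
have := bd (Num.bound (6 ^+ 4 / x ^+ 5)).+1 isT.
apply/negP; rewrite -ltNge -ltr_pdivrMr//.
apply: lt_trans (_ : (Num.bound (6 ^+ 4 / x ^+ 5))%:R < _); last by rewrite ltr_nat.
by rewrite archi_boundP// divr_ge0 ?exprn_ge0// ltW.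
Qed.

Lemma sqrt3_le_admissible (C : R) : 0 < C ->
  (forall d n (f : cube n -> R), (1 <= d)%N -> (1 <= n)%N -> (degree f <= d)%N ->
    pnorm 2 f <= C ^+ d * pnorm 1 f) -> Num.sqrt 3 <= C.
Proof.
move=> C0 H.
(* Admissibility is applied to the square of the level-k part, of degree at most 2 k; squaring the
   result gives C^(4 k). Level 0 is treated by hand, since admissibility assumes d >= 1. *)
have e4 n k : (0 < n)%N -> 2 ^- n * \sum_x @esym n k x ^+ 4
    <= C ^+ (4 * k) * (2 ^- n * \sum_x @esym n k x ^+ 2) ^+ 2.
  move=> n0; case: k => [|k].
    have E (x : cube n) : esym 0 x = 1.
      rewrite /esym (big_pred1 finset.set0) => [|S]; last by rewrite cards_eq0.
      by rewrite /walsh big_set0.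
    rewrite (eq_bigr (fun=> 1)) => [|x _]; last by rewrite E expr1n.
    rewrite [X in _ * X ^+ 2](_ : _ = 1).
      rewrite expr1n muln0 expr0 mul1r sumr_const card_ffun card_bool card_ord natrX.
      by rewrite mulVf// expf_neq0// pnatr_eq0.
    rewrite (eq_bigr (fun=> 1)) => [|x _]; last by rewrite E expr1n.
    by rewrite sumr_const card_ffun card_bool card_ord natrX mulVf// expf_neq0// pnatr_eq0.
  have := H (k.+1 + k.+1)%N n _ isT n0 (degree_esym_sqr n k.+1).
  rewrite pnorm1E pnorm2E.
  under eq_bigr => x _ do rewrite -exprM.
  under [X in _ <= _ * (_ * X)]eq_bigr => x _ do rewrite ger0_norm ?sqr_ge0//.
  set X := 2 ^- n * _; set Y := 2 ^- n * _ => HXY.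
  have X0 : 0 <= X.
    rewrite mulr_ge0 ?invr_ge0 ?exprn_ge0// sumr_ge0// => x _.
    by rewrite exprM sqr_ge0.
  have XE : X = Num.sqrt X ^+ 2 by rewrite sqr_sqrtr.
  rewrite XE; apply: le_trans (exprn_le 2 (sqrtr_ge0 _) HXY) _.
  rewrite exprMn -exprM; apply: ler_wpM2r; first exact: sqr_ge0.
  by rewrite addnn -mul2n mulnAC.
(* The left side is the mean of (1 + r)^4 and (1 - r)^4 for r = ep / C, the base of the fourth
   moment; the right side is the squared base of the second moment at ep. *)
have main (ep : R) : 0 < ep ->
    1 + 6 * (ep / C) ^+ 2 + (ep / C) ^+ 4 <= (1 + ep ^+ 2) ^+ 2.
  move=> ep0; apply: exp_poly_bound_le.
  - by have := sqr_ge0 (ep / C); have := sqr_ge0 ((ep / C) ^+ 2); rewrite -exprM; lra.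
  - by rewrite exprn_gt0//; have := sqr_ge0 ep; lra.
  move=> n n0; set r := ep / C.
  have -> : (1 + 6 * r ^+ 2 + r ^+ 4) ^+ n = 2 ^- n * \sum_x @riesz n r x ^+ 4.
    by rewrite mean_riesz; congr (_ ^+ _); field.
  have wn : 0 <= 2 ^- n :> R by rewrite invr_ge0 exprn_ge0.
  (* Splitting into n + 1 levels costs (n + 1)^3, and summing the bounds over the levels another n +
     1. *)
  apply: (@le_trans _ _ (2 ^- n * \sum_x n.+1%:R ^+ 3 * \sum_(k < n.+1) (r ^+ k * @esym n k x) ^+ 4)).
    rewrite ler_wpM2l//; apply: ler_sum => x _; rewrite riesz_esym; exact: pow4_sum_le.
  rewrite -mulr_sumr exchange_big /= mulrCA [_ ^+ 4 in leRHS]exprSr -[leRHS]mulrA ler_wpM2l ?exprn_ge0//.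
  rewrite mulr_sumr.
  have -> : n.+1%:R * ((1 + ep ^+ 2) ^+ 2) ^+ n = \sum_(k < n.+1) ((1 + ep ^+ 2) ^+ n) ^+ 2 :> R.
    by rewrite sumr_const card_ord mulr_natl exprAC.
  apply: ler_sum => k _.
  under eq_bigr => x _ do rewrite exprMn.
  rewrite -mulr_sumr mulrCA.
  apply: le_trans (ler_wpM2l _ (e4 n k n0)) _; first by rewrite !exprn_ge0 ?divr_ge0 ?(ltW ep0) ?(ltW C0).
  (* Because r = ep / C, the factor C^(4 k) is absorbed by the change of parameter from r to ep. *)
  have -> : (r ^+ k) ^+ 4 * (C ^+ (4 * k) * (2 ^- n * \sum_x @esym n k x ^+ 2) ^+ 2)
     = (ep ^+ (2 * k) * (2 ^- n * \sum_x @esym n k x ^+ 2)) ^+ 2.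
    have rC : r * C = ep by rewrite divfK ?gt_eqF.
    rewrite -rC; move: (2 ^- n * _) (r) => Z r'.
    rewrite -exprM [(k * 4)%N]mulnC mulrA -exprMn [RHS]exprMn -exprM.
    by rewrite mulnAC.
  apply: exprn_le; last exact: mean_esym_le.
  rewrite mulr_ge0 ?exprn_ge0 ?(ltW ep0)// mulr_ge0// sumr_ge0// => x _; exact: sqr_ge0.
apply: (sqr_le_le (ltW C0)); rewrite sqr_sqrtr// leNgt; apply/negP => C3.
(* With de the excess of 6 / C^2 over 2, [main] forces de <= ep^2; the choice ep^2 = de / 2 refutes
   it without any limit. *)
pose de : R := 6 / C ^+ 2 - 2.
have C2 : 0 < C ^+ 2 by rewrite exprn_gt0.
have de0 : 0 < de by rewrite subr_gt0 ltr_pdivlMr//; lra.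
pose ep := Num.sqrt (de / 2).
have ep2 : ep ^+ 2 = de / 2 by rewrite sqr_sqrtr//; lra.
have ep0 : 0 < ep by rewrite sqrtr_gt0; lra.
have := main ep ep0.
have -> : (1 + ep ^+ 2) ^+ 2 = 1 + ep ^+ 2 * (2 + ep ^+ 2) by ring.
have -> : 6 * (ep / C) ^+ 2 = ep ^+ 2 * (de + 2).
  by rewrite /de; field; rewrite gt_eqF.
have := exprn_ge0 2 (exprn_ge0 2 (divr_ge0 (ltW ep0) (ltW C0))); rewrite -exprM.
rewrite ep2; have := mulr_gt0 de0 de0; lra.
Qed.
End Lower.

Theorem theorem2 (R : realType) :
  Num.sqrt (3 : R) <= Cstar R /\ Cstar R < 2409 / 1000.
Proof.
have adm : [set C : R | 0 < C /\
    forall (d n : nat) (f : cube n -> R),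
      (1 <= d)%N -> (1 <= n)%N -> (degree f <= d)%N ->
      pnorm 2 f <= C ^+ d * pnorm 1 f] (expR (7 / 8)).
  split; first exact: expR_gt0.
  by move=> d n f d0 _ fd; apply: pnorm2_le_pnorm1.
split.
  apply: lb_le_inf; first by exists (expR (7 / 8)).
  by move=> C [C0 HC]; apply: sqrt3_le_admissible.
apply: le_lt_trans (expR_7_8 R); apply: ge_inf => //.
by exists 0 => C [/ltW].
Qed.
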